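(* For every $k\ge 1$, there exists $C>0$ such that the following holds: if $G$ is a planar graph, then there exists a $k$-deep $C$-wallet $\mathcal{H}$ of $G$.
   Context: Graphs are finite and simple; $v(G)=|V(G)|$, $d_G(v)$ is the degree of $v$ in $G$. Let $G$ be a graph, $H$ an induced subgraph of $G$, and $C,k>0$. The coboundary of $H$ in $G$ is $\bigcup_{v\in V(H)}N(v)\setminus V(H)$. We say $H$ is: - a purse if $H$ is connected, the coboundary $S$ of $H$ has size at most two, and the graph $G[S\cup V(H)]+\{uv: u\ne v\in S\}$ is planar; - a $C$-pocket if $H$ is connected, $v(H)\le C$ and $d_G(v)\le C$ for every $v\in V(H)$; - $k$-deep if the coboundary of $H$ is non-empty and has size at most $\frac1k v(H)$. Two subgraphs $H_1,H_2$ of $G$ are non-touching if $V(H_1)\cap V(H_2)=\emptyset$ and there is no edge of $G$ with one end in $V(H_1)$ and the other in $V(H_2)$. A $C$-wallet of $G$ is a set $\mathcal{H}$ of induced subgraphs of $G$ such that every $H\in\mathcal{H}$ is a $C$-pocket, every two distinct $H_1, H_2\in\mathcal{H}$ are non-touching, and $|\mathcal{H}|\ge\frac{1}{2C}v(G)$. A $C$-wallet $\mathcal{H}$ is $k$-deep if every $H\in\mathcal{H}$ is a purse or $k$-deep. *)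

(* Defs.v *)
From HB Require Import structures.
From mathcomp Require Import all_boot all_order all_algebra.
From mathcomp Require Import boolp classical_sets set_interval reals topology normedtype.

Set Implicit Arguments.
Unset Strict Implicit.
Unset Printing Implicit Defensive.

Import Order.TTheory GRing.Theory Num.Theory.
Import numFieldNormedType.Exports.

Local Open Scope ring_scope.

Record sgraph := SGraph {
  vertex :> finType;
  adj : rel vertex;
  adj_sym : symmetric adj;
  adj_irr : irreflexive adj }.

Definition neighbors (G : sgraph) (v : G) : {set G} := [set u | adj v u].

Definition degree (G : sgraph) (v : G) : nat := #|neighbors v|.

Section Constructions.
Variable G : sgraph.

Section Induced.
Variable A : {set G}.

Definition induced_vertex : finType := {x : G | x \in A}.

Definition induced_adj : rel induced_vertex := fun x y => adj (val x) (val y).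

Lemma induced_sym : symmetric induced_adj.
Proof. by move=> x y; rewrite /induced_adj adj_sym. Qed.

Lemma induced_irr : irreflexive induced_adj.
Proof. by move=> x; rewrite /induced_adj adj_irr. Qed.

Definition induced : sgraph := SGraph induced_sym induced_irr.
End Induced.

Section AddClique.
Variable S : {set G}.

Definition add_clique_adj : rel G :=
  fun x y => adj x y || [&& x \in S, y \in S & x != y].

Lemma add_clique_sym : symmetric add_clique_adj.
Proof.
by move=> x y; rewrite /add_clique_adj adj_sym andbCA [x == y]eq_sym.
Qed.

Lemma add_clique_irr : irreflexive add_clique_adj.
Proof. by move=> x; rewrite /add_clique_adj adj_irr eqxx !andbF. Qed.

Definition add_clique : sgraph := SGraph add_clique_sym add_clique_irr.
End AddClique.

End Constructions.

(* The null graph is not connected. *)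
Definition connected_graph (G : sgraph) : Prop :=
  (0 < #|G|)%N /\ forall x y : G, connect (@adj G) x y.

Section Planarity.
Local Open Scope classical_set_scope.
Variable R : realType.

(* [a] is the image of a simple (injective) curve from [p] to [q] in R^2. *)
Definition is_arc (a : set (R * R)) (p q : R * R) : Prop :=
  exists f : R -> R * R,
    [/\ {within `[0, 1], continuous f},
        {in `[0, 1] &, injective f},
        f 0 = p, f 1 = q & a = f @` `[0, 1]].

(* A drawing without crossings: [p] places the vertices, [a u v] is the arc
   representing the edge uv (its value is irrelevant if uv is not an edge).
   The interior of an arc avoids all vertices and all other arcs. *)
Definition plane_drawing (G : sgraph) (p : G -> R * R)
    (a : G -> G -> set (R * R)) : Prop :=
  let interior u v := a u v `\` [set p u; p v] in
  [/\ injective p,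
      forall u v, adj u v -> is_arc (a u v) (p u) (p v),
      forall u v, adj u v -> a u v = a v u,
      forall u v w, adj u v -> ~ interior u v (p w)
    & forall u v x y, adj u v -> adj x y ->
        ~ (u = x /\ v = y) -> ~ (u = y /\ v = x) ->
        interior u v `&` a x y = set0].

Definition planar (G : sgraph) : Prop :=
  exists p a, @plane_drawing G p a.

End Planarity.

(* An induced subgraph of [G] is given by its vertex set [A]; the induced
   subgraph itself is [induced A]. *)

Definition coboundary (G : sgraph) (A : {set G}) : {set G} :=
  (\bigcup_(v in A) neighbors v) :\: A.

Definition non_touching (G : sgraph) (A B : {set G}) : Prop :=
  [disjoint A & B] /\ forall x y, x \in A -> y \in B -> ~~ adj x y.

Section Wallets.
Variables (R : realType) (G : sgraph).
Implicit Types (A : {set G}) (C k : R) (W : {set {set G}}).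

Definition purse A : Prop :=
  let S := coboundary A in
  let GSA := induced (S :|: A) in
  [/\ connected_graph (induced A), (#|S| <= 2)%N
    & planar R (add_clique [set x : GSA | val x \in S])].

Definition pocket C A : Prop :=
  [/\ connected_graph (induced A), #|A|%:R <= C
    & forall v, v \in A -> (degree v)%:R <= C].

Definition deep k A : Prop :=
  coboundary A != finset.set0 /\ #|coboundary A|%:R <= k^-1 * #|A|%:R.

Definition wallet C W : Prop :=
  [/\ forall A, A \in W -> pocket C A,
      forall A B, A \in W -> B \in W -> A != B -> non_touching A B
    & (2 * C)^-1 * #|G|%:R <= #|W|%:R].

Definition deep_wallet k C W : Prop :=
  wallet C W /\ forall A, A \in W -> purse A \/ deep k A.

End Wallets.

(* Main.v *)
(** Delete the vertices of large degree and the breadth-first levels hit by three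
    successive Klein-Plotkin-Rao chops.  This removes a set X of at most eps v(G)
    vertices and leaves components of bounded size and degree, which do not touch
    each other.  A component A that is neither a purse nor k-deep satisfies
    |A| < k |S| for its coboundary S, a subset of X of size at least two.  No two
    of these components have the same coboundary of size two: an arc drawn through
    one would make the other a purse.  Contracting them suitably onto X gives
    minors of G, whose sparsity yields a bound O(|X|) on the sum of the |S|.  So
    the bad components cover few vertices, and the others form the wallet.

    Apart from the surgery on arcs, the only consequence of planarity in use is the
    absence of K_{3,3} minors, from which sparsity follows by Mader's contraction
    argument.  It is proved with van Kampen's parity argument, after replacing
    the arcs by walks on a fine square lattice. *)

Require Import Defs.
From mathcomp Require Import all_boot all_order all_algebra.
From mathcomp Require Import zify lra reals.
From mathcomp Require boolp classical_sets set_interval topology normedtype.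

Set Implicit Arguments.
Unset Strict Implicit.
Unset Printing Implicit Defensive.

(** * Connected sets and K_{3,3} minors *)

Section Connected.
Variable G : sgraph.
Implicit Types (A B U : {set G}) (x y : G).

(** Many components may attach to the same two vertices of X, as in K_{2,n}, and then the sum of the
    |S| is not O(|X|): this is the obstacle that purses absorb. Three common vertices are harmless,
    since three components attached to them form a K_{3,3}. It is essential that the constant in the
    bound on the sum depends neither on k nor on the sizes of the components. Thus eps can be fixed
    first, as a constant divided by k, then the degree bound and the distance between deleted
    levels, and only at the end C.

    The parity of crossings takes the place of the Jordan curve theorem and of Euler's formula. It
    compares only edges of K_{3,3} without a common end. So the walks that represent the edges of a
    minor may overlap inside a common branch set, and no subdivision of K_{3,3} has to be extracted
    from the minor. *)

Definition restr A : rel G := [rel x y | [&& x \in A, y \in A & adj x y]].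

(** Connectedness is expressed by paths of [G] that stay in [A], so that unions and subsets need no
    change of vertex type; [conn_induced] passes to the induced graph. *)
Definition conn A : Prop :=
  A != set0 /\ {in A &, forall x y, connect (restr A) x y}.

Definition touch A B : Prop := exists x y, [/\ x \in A, y \in B & adj x y].

Lemma restr_sym A : symmetric (restr A).
Proof. by move=> x y; rewrite /restr /= andbCA adj_sym. Qed.

Lemma restr_csym A : connect_sym (restr A).
Proof. exact/sym_connect_sym/restr_sym. Qed.

Lemma connect_restrS A B x y :
  A \subset B -> connect (restr A) x y -> connect (restr B) x y.
Proof.
move=> AB; apply: connect_sub => u v /and3P[uA vA uv].
by apply: connect1; rewrite /restr /= !(subsetP AB).
Qed.

Lemma connect_restr_in A x y : connect (restr A) x y -> x \in A -> y \in A.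
Proof.
case/connectP=> c + ->; elim: c x => //= z c IH x /andP[/and3P[_ zA _]] + _.
by move/IH; apply.
Qed.

Lemma connect_restr_adj A x y : x \in A -> y \in A -> adj x y -> connect (restr A) x y.
Proof. by move=> xA yA xy; apply: connect1; rewrite /restr /= xA yA. Qed.

Lemma conn1 x : conn [set x].
Proof.
split; first by apply/set0Pn; exists x; rewrite inE.
by move=> u v /set1P-> /set1P->.
Qed.

Lemma connU A B : conn A -> conn B -> touch A B -> conn (A :|: B).
Proof.
move=> [/set0Pn[a aA] cA] [_ cB] [x [y [xA yB xy]]].
split; first by apply/set0Pn; exists a; rewrite inE aA.
have toy z : z \in A :|: B -> connect (restr (A :|: B)) z y.
  case/setUP=> zAB; last by apply: connect_restrS (subsetUr _ _) (cB _ _ zAB yB).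
  apply: (connect_trans (connect_restrS (subsetUl _ _) (cA _ _ zAB xA))).
  by apply: connect_restr_adj; rewrite ?inE ?xA ?yB ?orbT.
by move=> u v /toy uy /toy vy; rewrite (connect_trans uy) // restr_csym.
Qed.

Lemma conn_meet A B x : conn A -> conn B -> x \in A -> x \in B -> conn (A :|: B).
Proof.
move=> [_ cA] [_ cB] xA xB; split; first by apply/set0Pn; exists x; rewrite inE xA.
have tox z : z \in A :|: B -> connect (restr (A :|: B)) z x.
  case/setUP=> zAB; first exact: connect_restrS (subsetUl _ _) (cA _ _ zAB xA).
  exact: connect_restrS (subsetUr _ _) (cB _ _ zAB xB).
by move=> u v /tox ux /tox vx; rewrite (connect_trans ux) // restr_csym.
Qed.

Lemma touch_sym A B : touch A B -> touch B A.
Proof. by case=> x [y [? ? ?]]; exists y, x; rewrite adj_sym. Qed.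

Lemma touchS A A' B B' : A \subset A' -> B \subset B' -> touch A B -> touch A' B'.
Proof.
by move=> /subsetP AA /subsetP BB [x [y [? ? ?]]]; exists x, y; split=> //; auto.
Qed.

End Connected.

Lemma disjoint_notin (T : finType) (A B : {set T}) :
  (forall y, y \in A -> y \notin B) -> [disjoint A & B].
Proof. by move=> AB; rewrite disjoint_subset; apply/subsetP => y /AB. Qed.

Definition K33_model (G : sgraph) (A B : 'I_3 -> {set G}) : Prop :=
  [/\ forall i, conn (A i), forall j, conn (B j),
      forall i k, i != k -> [disjoint A i & A k] /\ [disjoint B i & B k],
      forall i j, [disjoint A i & B j] & forall i j, touch (A i) (B j)].

Definition K33_free (G : sgraph) : Prop :=
  forall A B : 'I_3 -> {set G}, ~ K33_model A B.

(** * Parity of crossings of lattice walks *)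

Module Lattice.
Import Order.TTheory GRing.Theory Num.Theory.
Local Open Scope ring_scope.

Definition pt := (int * int)%type.

Definition ustep (p q : pt) : bool :=
  ((p.1 == q.1) && ((q.2 == p.2 + 1) || (p.2 == q.2 + 1)))
  || ((p.2 == q.2) && ((q.1 == p.1 + 1) || (p.1 == q.1 + 1))).

(** Distance at most [m] in the maximum norm. *)
Definition nearby (m : int) (p s : pt) : bool :=
  [&& p.1 <= s.1 + m, s.1 <= p.1 + m, p.2 <= s.2 + m & s.2 <= p.2 + m].

Definition swest (s : pt) : pt := (s.1 - 1, s.2 - 1).

Definition left_of (p s : pt) : bool := p.1 <= s.1.

(* The step pq crosses the vertical ray going up from s + (1/2, 1/2); the ray of
   [swest s] thus starts at s - (1/2, 1/2). *)
Definition hit (s p q : pt) : bool :=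
  (s.2 < p.2) && ((p.1 == s.1) && (q.1 == s.1 + 1) || (q.1 == s.1) && (p.1 == s.1 + 1)).

Lemma hit_east s (x y : int) : hit s (x, y) (x + 1, y) = (s.2 < y) && (x == s.1).
Proof. rewrite /hit /=; lia. Qed.

Lemma hit_west s (x y : int) : hit s (x + 1, y) (x, y) = (s.2 < y) && (x == s.1).
Proof. rewrite /hit /=; lia. Qed.

Lemma hit_vert s (x y z : int) : hit s (x, y) (x, z) = false.
Proof. rewrite /hit /=; lia. Qed.


Lemma ltB1 (x y : int) : (x - 1 < y) = ~~ (y < x).
Proof. lia. Qed.


(** The case of two horizontal steps in [step_step], oriented to the east; [b] says that the second
    step is strictly lower. *)
Lemma east_east (b : bool) (p s : int) :
  (b && (p == s) (+) b && (p == s + 1)) (+)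
  (~~ b && (s == p - 1) (+) ~~ b && (s == p + 1 - 1)) =
  ((p <= s) (+) (p + 1 <= s)) (+) ((p <= s + 1) (+) (p + 1 <= s + 1)).
Proof. case: b => /=; lia. Qed.

(** For a horizontal and a vertical step in [step_step]: points in the same or in adjacent columns
    can be far apart only vertically, so one step passes entirely above the other. *)
Lemma far_vert (p s a b : int) :
  ~~ [&& p <= s + 1, s <= p + 1, a <= b + 1 & b <= a + 1] ->
  (p == s) || (s == p - 1) || (s == p + 1) -> (b + 1 < a) || (a + 1 < b).
Proof. lia. Qed.

Lemma step_step p q s t : ustep p q -> ustep s t ->
  ~~ nearby 1 p s -> ~~ nearby 1 p t -> ~~ nearby 1 q s -> ~~ nearby 1 q t ->
  (hit s p q (+) hit t p q) (+) (hit (swest p) s t (+) hit (swest q) s t)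
   = (left_of p s (+) left_of q s) (+) (left_of p t (+) left_of q t).
Proof.
case: p q s t => [p p'] [q q'] [s s'] [t t'].
case/orP=> /= /andP[/eqP <- /orP[]/eqP ->]; case/orP=> /= /andP[/eqP <- /orP[]/eqP ->];
rewrite ?hit_east ?hit_west ?hit_vert ?addbb //= ?addbF ?ltB1 /nearby /left_of /= => n1 n2 n3 n4.
all: try (first [rewrite east_east
  | rewrite [in X in _ (+) X]addbC east_east
  | rewrite [in X in X (+) _]addbC east_east
  | rewrite [in X in X (+) _]addbC [in X in _ (+) X]addbC east_east];
  by do ?case: (_ <= _)).
all: case: eqP => [E|_]; rewrite ?andbF //= !andbT;
  have := far_vert n1; have := far_vert n2; have := far_vert n3; have := far_vert n4;
  move: E; clear; lia.
Qed.

Fixpoint hits (s p : pt) (c : seq pt) : bool :=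
  if c is q :: c' then hit s p q (+) hits s q c' else false.

(** The crossing identity telescopes along a walk: the terms at an intermediate vertex occur twice
    and cancel. This form extends the second walk, [addb_glue2] the first one. *)
Lemma addb_glue A B C x X y Y u v w :
  (A (+) B) (+) (x (+) y) = u (+) v -> (B (+) C) (+) (X (+) Y) = v (+) w ->
  (A (+) C) (+) ((x (+) X) (+) (y (+) Y)) = u (+) w.
Proof.
move=> e1 e2; have -> : u (+) w = (u (+) v) (+) (v (+) w).
  by rewrite addbA addbK.
rewrite -e1 -e2; clear; rewrite [RHS]addbACA (addbACA x X).
by congr (_ (+) _); rewrite addbA addbK.
Qed.

Lemma addb_glue2 A B C D x y z u v w u' v' w' :
  (A (+) B) (+) (x (+) y) = (u (+) v) (+) (u' (+) v') ->
  (C (+) D) (+) (y (+) z) = (v (+) w) (+) (v' (+) w') ->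
  ((A (+) C) (+) (B (+) D)) (+) (x (+) z) = (u (+) w) (+) (u' (+) w').
Proof.
move=> e1 e2; have tel p q r : p (+) r = (p (+) q) (+) (q (+) r) by rewrite addbA addbK.
rewrite (tel u v) (tel u' v') (tel x y) [RHS]addbACA -e1 -e2 (addbACA A C).
by rewrite [RHS]addbACA.
Qed.

Lemma step_walk p q s d : ustep p q -> path ustep s d ->
  {in s :: d, forall y, ~~ nearby 1 p y && ~~ nearby 1 q y} ->
  (hit s p q (+) hit (last s d) p q) (+) (hits (swest p) s d (+) hits (swest q) s d)
   = (left_of p s (+) left_of q s) (+) (left_of p (last s d) (+) left_of q (last s d)).
Proof.
move=> pq; elim: d s => [|t d IH] s /=; first by rewrite !addbb.
case/andP=> st td far.
have /andP[ps qs] := far s (mem_head _ _).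
have /andP[pt qt] : ~~ nearby 1 p t && ~~ nearby 1 q t by apply: far; rewrite !inE eqxx orbT.
apply: addb_glue (step_step pq st ps pt qs qt) (IH _ td _).
by move=> y yt; apply: far; rewrite inE yt orbT.
Qed.

(* Modulo 2, the number of crossings of a walk with another one shifted by
   (1/2, 1/2) is the sum of the crossings of each with the rays at the ends of the
   other and of the terms comparing the abscissas of the ends.  Walks that stay
   apart do not cross, which leaves this identity. *)
Lemma walk_walk p c s d : path ustep p c -> path ustep s d ->
  {in p :: c & s :: d, forall x y, ~~ nearby 1 x y} ->
  (hits s p c (+) hits (last s d) p c) (+)
    (hits (swest p) s d (+) hits (swest (last p c)) s d)
   = (left_of p s (+) left_of (last p c) s) (+)
     (left_of p (last s d) (+) left_of (last p c) (last s d)).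
Proof.
move=> + sd; elim: c p => [|q c IH] p /=; first by rewrite !addbb.
case/andP=> pq qc far.
have step : {in s :: d, forall y, ~~ nearby 1 p y && ~~ nearby 1 q y}.
  by move=> y ys; rewrite !far // !inE eqxx ?orbT.
apply: addb_glue2 (step_walk pq sd step) (IH _ qc _).
by move=> x y xq; apply: far; rewrite inE xq orbT.
Qed.

(** Moving the ray from one side of [s] to the other is [walk_walk] for the walk of two steps from
    [swest s] to [s]. Distance 2 from [s] leaves distance 1 from this walk, and the conditions on
    abscissas make the remaining terms vanish or cancel. *)
Lemma hits_swest s p c : path ustep p c -> {in p :: c, forall x, ~~ nearby 2 x s} ->
  p.1 != s.1 -> (last p c).1 != s.1 -> hits (swest s) p c = hits s p c.
Proof.
move=> pc far ps qs.
have sd : path ustep (swest s) [:: (s.1 - 1, s.2); s].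
  by rewrite /= /ustep /=; lia.
have away x y : x \in p :: c -> y \in [:: swest s; (s.1 - 1, s.2); s] -> ~~ nearby 1 x y.
  move=> /far + ; rewrite !inE => nx /or3P[]/eqP->;
  by move: nx; rewrite /nearby /swest /=; lia.
have side x : x.1 != s.1 -> left_of x (swest s) = left_of x s.
  by rewrite /left_of /swest /=; lia.
have miss x : x.1 != s.1 -> hits (swest x) (swest s) [:: (s.1 - 1, s.2); s] = false.
  by rewrite /= /hit /swest /=; lia.
have := walk_walk pc sd away; rewrite !miss // !side // addbF /=.
by case: (hits _ p c); case: (hits _ p c); do 2 case: (left_of _ _).
Qed.

(** Each [t j] and each [s l] occurs in two summands and cancels. Each of the three pairs j, l
    contributes [h j l (+) h l j = true], and three is odd. *)
Lemma parity_K33 (t s : 'I_3 -> bool) (h X Y : 'I_3 -> 'I_3 -> bool) :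
  (forall j l, j != l -> X j l (+) Y l j = (t j (+) s l) (+) h j l) ->
  (forall j l, j != l -> h j l = ~~ h l j) ->
  (\big[addb/false]_j \big[addb/false]_(l | l != j) X j l) (+)
  (\big[addb/false]_j \big[addb/false]_(l | l != j) Y j l) = true.
Proof.
move=> E H.
have -> : \big[addb/false]_j \big[addb/false]_(l | l != j) Y j l =
  \big[addb/false]_j \big[addb/false]_(l | l != j) Y l j.
  by rewrite (exchange_big_dep xpredT) //=; under eq_bigr do under eq_bigl do rewrite eq_sym.
rewrite -big_split /=.
under eq_bigr => j _ do rewrite -big_split /=.
under eq_bigr => j _ do under eq_bigr => l lj do rewrite E 1?eq_sym //.
under eq_bigr do rewrite big_mkcond.
rewrite !big_ord_recl !big_ord0 /=.
set z : 'I_3 := lift ord0 (lift ord0 ord0); set y : 'I_3 := lift ord0 ord0; set x : 'I_3 := ord0.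
rewrite (H y x) // (H z x) // (H z y) // /=.
by case: (t x); case: (t y); case: (t z); case: (s x); case: (s y); case: (s z);
 case: (h x y); case: (h x z); case: (h y z).
Qed.

(* Summed over all pairs of independent edges of K_{3,3}, the ray terms cancel
   modulo 2 while the comparison terms do not. *)
Lemma no_lattice_K33 (a b : 'I_3 -> pt) (c : 'I_3 -> 'I_3 -> seq pt) :
  (forall i j, path ustep (a i) (c i j)) -> (forall i j, last (a i) (c i j) = b j) ->
  (forall i j k l, i != k -> j != l ->
     {in a i :: c i j & a k :: c k l, forall x y, ~~ nearby 2 x y}) ->
  (forall j l, j != l -> (b j).1 != (b l).1) -> (forall i j, (a i).1 != (b j).1) -> False.
Proof.
move=> walk cb far bb ab.
have near12 x y : ~~ nearby 2 x y -> ~~ nearby 1 x y.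
  by rewrite /nearby; lia.
have bc i j : b j \in a i :: c i j by rewrite -(cb i j) mem_last.
(* The crossings of the walks from [a i] with the rays at the other [b l]. In [SS] the rays at [a i]
   and [a k] go into the terms [s] and [t] of [parity_K33], which cancel. *)
pose S (s : pt -> pt) i :=
  \big[addb/false]_j \big[addb/false]_(l | l != j) hits (s (b l)) (a i) (c i j).
have SS i k : i != k -> S id i (+) S swest k = true.
  move=> ik; apply: (parity_K33 (t := fun j => hits (a k) (a i) (c i j) (+) left_of (b j) (a k))
   (s := fun l => hits (swest (a i)) (a k) (c k l) (+) (left_of (a i) (a k) (+) left_of (a i) (b l)))
   (h := fun j l => left_of (b j) (b l))) => j l jl; last first.
    by have := bb j l jl; rewrite /left_of; lia.
  have far1 : {in a i :: c i j & a k :: c k l, forall x y, ~~ nearby 1 x y}.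
    by move=> x y xc yc; apply/near12/(far i j k l).
  have := walk_walk (walk i j) (walk k l) far1; rewrite !cb.
  case: (hits _ _ _); case: (hits _ _ _); case: (hits _ _ _); case: (hits _ _ _);
  by case: (left_of _ _); case: (left_of _ _); case: (left_of _ _); case: (left_of _ _).
have S1 : S swest 1 = S id 1.
  apply: eq_bigr => j _; apply: eq_bigr => l lj; apply: hits_swest; rewrite ?ab //.
  - move=> x xc; apply: (far 1 j 0 l) => //; first by rewrite eq_sym.
  - by rewrite cb bb // eq_sym.
(* The three relations add up to [S swest 1 (+) S id 1 = true], contrary to [S1]. *)
by have := SS 0 1; have := SS 0 2; have := SS 1 2; rewrite S1; do 3 case: (S _ _); auto.
Qed.

End Lattice.

(** * Plane drawings *)

Module Drawings.
Import Order.TTheory GRing.Theory Num.Theory.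
Import boolp classical_sets set_interval topology normedtype.
Import numFieldNormedType.Exports.
Import Lattice.
Local Open Scope ring_scope.
Local Open Scope classical_set_scope.

(** * Compactness of curves and rounding to the lattice *)

Section Curves.
Variable R : realType.
Implicit Types (f g : R -> R * R) (e d t : R).

Lemma within01P f : {within `[0, 1], continuous f} <->
  forall x, `[0, 1] x -> forall e, 0 < e ->
    exists2 d, 0 < d & forall t, `[0, 1] t -> `|x - t| < d -> ball (f x) e (f t).
Proof.
split=> [cf x x01 e e0 | H].
  have N : nbhs_subspace x (f @^-1` ball (f x) e) := cf x _ (nbhsx_ballx (f x) e e0).
  rewrite -(nbhs_subspace_in x01) in N; case/nbhs_ballP: N => d d0 N.
  by exists d => // t t01 xt; apply: N.
apply/subspace_continuousP => x x01 B /nbhs_ballP[e /= e0 eB].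
have [d d0 dB] := H x x01 e e0; apply/nbhs_ballP; exists d => //= t xt t01.
exact/eB/dB.
Qed.

Lemma in01 t : `[0, 1] t <-> 0 <= t <= 1.
Proof. by rewrite /= in_itv. Qed.

Lemma within01_unif f e : {within `[0, 1], continuous f} -> 0 < e ->
  exists2 d, 0 < d & forall s t, `[0, 1] s -> `[0, 1] t -> `|s - t| < d -> ball (f s) e (f t).
Proof.
move=> cf e0; have /compact_near_coveringP cov := @segment_compact R 0 1.
have /cov : forall x : R, `[0, 1] x -> \forall s \near x & d \near (0 : R)^'+,
    `[0, 1] s -> forall t, `[0, 1] t -> `|s - t| < d -> ball (f s) e (f t).
  move=> x x01; have e20 : 0 < e / 2 by rewrite divr_gt0.
  have [d d0 near] := (within01P f).1 cf x x01 _ e20.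
  have d20 : 0 < d / 2 by rewrite divr_gt0.
  exists (ball x (d / 2), [set d' | d' < d / 2]).
    by split; [apply: nbhsx_ballx | apply: nbhs_right_lt].
  move=> [s d'] /= [xs d'd] s01 t t01 st; apply: (@ball_splitr _ _ (f x)).
    apply: near => //; apply: (lt_trans xs); lra.
  apply: near => //; rewrite -(subrKA s); apply: le_lt_trans (ler_normD _ _) _.
  move: xs; rewrite /ball /=; lra.
move=> H; have [d [/= {}H d0]] := filter_ex (filterI H (nbhs_right_gt 0)).
by exists d => // s t s01; apply: H.
Qed.

Lemma compact_sep (A B : set (R * R)) : compact A -> compact B -> A `&` B = set0 ->
  \forall e \near (0 : R)^'+, forall x y, A x -> B y -> ~ ball x e y.
Proof.
move=> /compact_near_coveringP cov cB AB.
have clB : closed B by apply: compact_closed => //; exact: norm_hausdorff.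
have /cov : forall x, A x -> \forall s \near x & e \near (0 : R)^'+,
    forall y, B y -> ~ ball s e y.
  move=> x Ax; have : nbhs x (~` B).
    apply: open_nbhs_nbhs; split; first exact: closed_openC.
    by move=> Bx; have : (A `&` B) x by []; rewrite AB.
  case/nbhs_ballP=> d /= d0 H; have d20 : 0 < d / 2 by rewrite divr_gt0.
  exists (ball x (d / 2), [set e | e < d / 2]).
    by split; [apply: nbhsx_ballx | apply: nbhs_right_lt].
  move=> [s e] /= [xs ed] y By sy; apply: (H y) => //.
  by apply: ball_split xs _; apply: le_ball sy; apply: ltW.
by apply: filterS => e H x y Ax By; apply: H.
Qed.

Definition grid d (z : R * R) : pt := (Num.floor (z.1 / d), Num.floor (z.2 / d)).

(** The bound is 2d, not d: a corner inserted between two rounded points takes one coordinate from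
    each, and the points themselves may differ by d. *)
Definition shadows d (v : pt) (z : R * R) : Prop :=
  `|v.1%:~R * d - z.1| <= 2 * d /\ `|v.2%:~R * d - z.2| <= 2 * d.

Lemma floor_close d x : 0 < d -> `|(Num.floor (x / d))%:~R * d - x| <= d.
Proof.
move=> d0; have /andP[] := floor_itv (x / d).
rewrite ler_pdivlMr // ltr_pdivrMr // intrD mulrDl mul1r; move: (_ * d) => y.
by move=> yx xy; rewrite ler_norml; lra.
Qed.

Lemma grid_shadows d z : 0 < d -> shadows d (grid d z) z.
Proof.
move=> d0; split; apply: le_trans (floor_close _ d0) _; lra.
Qed.

Lemma floor_step d x y : 0 < d -> `|x - y| < d ->
  (Num.floor (x / d) <= Num.floor (y / d) + 1)%R.
Proof.
move=> d0 xy; have xyd : x / d <= y / d + 1.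
  rewrite ler_pdivrMr // mulrDl mul1r divfK ?gt_eqF //; move: xy; rewrite ltr_norml; lra.
rewrite -ltzD1 -(@ltr_int R) !intrD.
have /andP[+ _] := floor_itv (x / d); have /andP[_] := floor_itv (y / d); rewrite intrD; lra.
Qed.

End Curves.

Lemma ustep_near (m n m' n' : int) :
  m <= m' + 1 -> m' <= m + 1 -> n <= n' + 1 -> n' <= n + 1 ->
  exists c, [/\ path ustep (m, n) c, last (m, n) c = (m', n')
    & {in c, forall v, v = (m', n) \/ v = (m', n')}].
Proof.
move=> H1 H2 H3 H4.
exists ((if m == m' then [::] else [:: (m', n)]) ++
        (if n == n' then [::] else [:: (m', n')])).
case: (eqVneq m m') => [<-|mm]; case: (eqVneq n n') => [<-|nn] /=;
  rewrite ?andbT /ustep /= ?eqxx /=; split => //; try lia; move=> v; rewrite !inE.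
- by move/eqP; right.
- by move/eqP; left.
- by case/orP=> /eqP; [left | right].
Qed.

(** * Lattice walks along arcs *)

Section GridWalks.
Variable R : realType.
Implicit Types (f g : R -> R * R) (e d : R).

Lemma grid_step d (z w : R * R) : 0 < d -> ball z d w ->
  exists c, [/\ path ustep (grid d z) c, last (grid d z) c = grid d w
    & {in c, forall v, shadows d v w}].
Proof.
move=> d0 [zw1 zw2]; rewrite /ball /= in zw1 zw2.
have [||||c [cp cl cn]] := @ustep_near (grid d z).1 (grid d z).2 (grid d w).1 (grid d w).2.
- exact: floor_step.
- by apply: floor_step => //; rewrite distrC.
- exact: floor_step.
- by apply: floor_step => //; rewrite distrC.
exists c; split=> // v /cn[] ->; last exact: grid_shadows.
split=> /=; first by apply: le_trans (floor_close _ d0) _; lra.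
rewrite -(subrKA z.2); apply: le_trans (ler_normD _ _) _.
have := floor_close z.2 d0; lra.
Qed.

Lemma arc_walk (a : set (R * R)) p q d : is_arc a p q -> 0 < d ->
  exists c, [/\ path ustep (grid d p) c, last (grid d p) c = grid d q
    & {in grid d p :: c, forall v, exists2 z, a z & shadows d v z}].
Proof.
case=> f [cf _ <- <- ->] d0; have [e e0 ue] := within01_unif cf d0.
(* The arc is sampled at multiples of 1/N < e; by uniform continuity consecutive samples are then
   less than d apart. *)
pose N := (Num.truncn (e^-1)).+1; have N0 : 0 < N%:R :> R by rewrite ltr0n.
have Ne : N%:R^-1 < e by rewrite invf_plt ?posrE // truncnS_gt.
have in01 (i : nat) : (i <= N)%N -> `[0, 1] (i%:R / N%:R : R).
  by move=> iN; rewrite /= in_itv /= divr_ge0 ?ler0n // ler_pdivrMr // mul1r ler_nat.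
have walk i : (i <= N)%N -> exists c, [/\ path ustep (grid d (f 0)) c,
    last (grid d (f 0)) c = grid d (f (i%:R / N%:R))
    & {in grid d (f 0) :: c, forall v, exists2 z, (f @` `[0, 1]) z & shadows d v z}].
  elim: i => [_|i IH iN].
    exists [::]; rewrite mul0r; split=> // v; rewrite inE => /eqP->.
    by exists (f 0); [exists 0 => //; rewrite /= in_itv /= lexx ler01 | exact: grid_shadows].
  have [c [cp cl cn]] := IH (ltnW iN).
  have /(grid_step d0)[c' [cp' cl' cn']] : ball (f (i%:R / N%:R)) d (f (i.+1%:R / N%:R)).
    apply: ue; [exact/in01/ltnW | exact: in01 |].
    by rewrite distrC -mulrBl -natrB // subSnn mul1r ger0_norm // invr_ge0 ltW.
  exists (c ++ c'); rewrite cat_path last_cat cp cl; split=> //= v.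
  rewrite -cat_cons mem_cat => /orP[/cn //|/cn' cv].
  by exists (f (i.+1%:R / N%:R)) => //; exists (i.+1%:R / N%:R) => //; apply: in01.
have [c [cp cl cn]] := walk N (leqnn N); exists c; split=> //.
by rewrite cl divff // gt_eqF.
Qed.

End GridWalks.

(** * Shears of the plane *)

Section Shear.
Variable R : realType.
Implicit Types (z : R * R) (l : R).

Definition shear l z : R * R := (z.1 + l * z.2, z.2).

Lemma shear_inj l : injective (shear l).
Proof. by move=> [x y] [x' y'] [+ yy]; rewrite /= yy => /addIr->. Qed.

Lemma shear_continuous l : continuous (shear l).
Proof.
move=> z; have fg : (z'.1 + l * z'.2 @[z' --> z] --> z.1 + l * z.2); last first.
  exact: (cvg_pair fg cvg_snd).
by apply: cvgD; [exact: cvg_fst | apply: cvgMl_tmp; exact: cvg_snd].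
Qed.

Lemma shear_arc l (a : set (R * R)) p q :
  is_arc a p q -> is_arc (shear l @` a) (shear l p) (shear l q).
Proof.
case=> f [cf fi f0 f1 ->]; exists (shear l \o f); rewrite /= f0 f1; split=> //.
- apply: within_continuous_comp cf => z _; exact: shear_continuous.
- by move=> s t sI tI /shear_inj; apply: fi.
- by rewrite image_comp.
Qed.

End Shear.

Section Planar.
Variables (R : realType) (G : sgraph).
Implicit Types (p : G -> R * R) (a : G -> G -> set (R * R)) (l d : R).

(* The parity argument needs distinct abscissas. *)
Lemma shear_generic p : injective p ->
  exists l, injective (fun u => (shear l (p u)).1).
Proof.
move=> pI.
(* Two points of different ordinates get the same abscissa under the shear by [l] only if the
   absolute value of [l] is their [q u v]. One plus the sum of all these ratios exceeds each of
   them. *)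
pose q u v := `|(p u).1 - (p v).1| / `|(p u).2 - (p v).2|.
have q0 u v : 0 <= q u v by rewrite divr_ge0.
exists (1 + \sum_u \sum_v q u v) => u v; set l := 1 + _ => /= uv.
have lq : q u v < l.
  rewrite /l (bigD1 u) //= (bigD1 v) //=.
  have s1 : 0 <= \sum_(i | i != v) q u i by apply: sumr_ge0.
  have s2 : 0 <= \sum_(i | i != u) \sum_v0 q i v0.
    by apply: sumr_ge0 => i _; apply: sumr_ge0.
  lra.
have [y0|y0] := eqVneq ((p u).2 - (p v).2) 0.
  move/subr0_eq: y0 => y0; apply: pI; rewrite [p u]surjective_pairing [p v]surjective_pairing.
  by move: uv; rewrite y0 => /addIr->.
have l0 : 0 <= l by apply: le_trans (q0 u v) (ltW lq).
have : `|(p u).1 - (p v).1| = l * `|(p u).2 - (p v).2|.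
  rewrite -[in RHS](ger0_norm l0) -normrM -normrN; congr `|_|; lra.
by move=> e; move: lq; rewrite /q e mulfK ?normr_eq0 // ltxx.
Qed.

Lemma drawing_shear l p a : plane_drawing p a ->
  plane_drawing (shear l \o p) (fun u v => shear l @` a u v).
Proof.
case=> pI arc sym vtx edg; split=> /=.
- by move=> u v /= /shear_inj /pI.
- by move=> u v uv; apply/shear_arc/arc.
- by move=> u v uv; rewrite sym.
- move=> u v w uv [[z az /shear_inj zw] nw]; apply: (vtx u v w uv); rewrite -zw; split=> //.
  by move=> /= [] zp; apply: nw; rewrite /= -zw zp; [left | right].
- move=> u v x y uv xy n1 n2; rewrite -subset0 => z [[[z' az <-] nz] [z'' az'' /shear_inj e]].
  have : (a u v `\` [set p u; p v]) `&` a x y = set0 by apply: edg.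
  rewrite -subset0 => /(_ z'); apply; split; last by rewrite -e.
  by split=> // -[] zp; apply: nz; rewrite /= zp; [left | right].
Qed.

Lemma planar_generic : planar R G ->
  exists p a, plane_drawing p a /\ injective (fun u => (p u).1).
Proof.
case=> p [a pa]; have [pI _ _ _ _] := pa; have [l lI] := shear_generic pI.
by exists (shear l \o p), (fun u v => shear l @` a u v); split; [exact: drawing_shear|].
Qed.

Section Drawing.
Variables (p : G -> R * R) (a : G -> G -> set (R * R)).
Hypothesis pa : plane_drawing p a.

(* The value at a non-adjacent pair, in particular at [u = v], is a point. *)
Definition drawn (u v : G) : set (R * R) := if adj u v then a u v else [set p u].

Lemma arc_compact (b : set (R * R)) z w : is_arc b z w -> compact b.
Proof.
by case=> f [cf _ _ _ ->]; apply: continuous_compact cf _; apply: segment_compact.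
Qed.

Lemma drawn_compact u v : compact (drawn u v).
Proof.
rewrite /drawn; case: ifP => [uv|_]; last exact: compact_set1.
by have [_ arc _ _ _] := pa; apply: arc_compact (arc u v uv).
Qed.

Lemma drawn_disjoint u v x y : u != x -> u != y -> v != x -> v != y ->
  drawn u v `&` drawn x y = set0.
Proof.
have [pI arc sym vtx edg] := pa => ux uy vx vy.
have off s t w : adj s t -> w != s -> w != t -> ~ a s t (p w).
  move=> st ws wt aw; apply: (vtx s t w st); split=> // -[] /pI e.
    by rewrite e eqxx in ws.
  by rewrite e eqxx in wt.
rewrite -subset0 => z []; rewrite /drawn; case: ifP => uv; case: ifP => xy.
- move=> auv axy.
  have : (a u v `\` [set p u; p v]) `&` a x y = set0.
    by apply: edg => // -[e _]; [rewrite e eqxx in ux | rewrite e eqxx in uy].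
  rewrite -subset0 => /(_ z); apply; split=> //; split=> // -[] zp.
    by apply: (off x y u) => //; rewrite -zp.
  by apply: (off x y v) => //; rewrite -zp.
- by move=> + zx; rewrite zx => auv; apply: off auv; rewrite // eq_sym.
- by move=> ->; apply: off.
- by move=> -> /pI e; rewrite e eqxx in ux.
Qed.

Definition traces d (S : {set G}) (v : pt) : Prop :=
  exists x y, [/\ x \in S, y \in S & exists2 z, drawn x y z & shadows d v z].

Lemma traces_sep :
  \forall d \near (0 : R)^'+, forall (S T : {set G}) (v w : pt), [disjoint S & T]%B ->
    traces d S v -> traces d T w -> ~~ nearby 2 v w.
Proof.
have H : \forall e \near (0 : R)^'+, forall q : G * G * (G * G),
    q.1.1 != q.2.1 -> q.1.1 != q.2.2 -> q.1.2 != q.2.1 -> q.1.2 != q.2.2 ->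
    forall x y, drawn q.1.1 q.1.2 x -> drawn q.2.1 q.2.2 y -> ~ ball x e y.
  apply: filter_forall => -[[u v] [x y]] /=.
  case: (boolP [&& u != x, u != y, v != x & v != y]) => [/and4P[*]|]; last first.
    by move=> n; apply: nearW => d *; case/negP: n; apply/and4P.
  have := compact_sep (@drawn_compact u v) (@drawn_compact x y).
  by rewrite drawn_disjoint // => /(_ erefl); apply: filterS => e + _ _ _ _.
have [e [/= {}H e0]] := filter_ex (filterI H (nbhs_right_gt 0)).
near=> d => S T v w ST [x [y [xS yS [z dz [z1 z2]]]]] [x' [y' [xT yT [z' dz' [w1 w2]]]]].
have d0 : 0 < d by [].
(* Each of the two shadows costs 2d and the lattice distance another 2d, so the two points of the
   drawing would be at most 6d apart. *)
have de : 7 * d < e by rewrite mulrC -ltr_pdivlMr //; near: d; apply: nbhs_right_lt; rewrite divr_gt0.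
have ne s t : s \in S -> t \in T -> s != t.
  by move=> sS tT; apply: contraTneq sS => ->; rewrite (disjointFl ST).
apply/negP => /and4P[]; rewrite -!(ler_int R) !intrD => n1 n2 n3 n4.
apply: (H (x, y, (x', y')) _ _ _ _ z z') => //=; rewrite ?ne //.
have scale (i j : int) : i%:~R <= j%:~R + 2%:~R :> R -> i%:~R * d <= j%:~R * d + 2 * d.
  by move=> ij; rewrite -mulrDl ler_wpM2r // ltW.
move/scale: n1; move/scale: n2; move/scale: n3; move/scale: n4.
move: z1 z2 w1 w2; rewrite !ler_norml /ball /= => /andP[? ?] /andP[? ?] /andP[? ?] /andP[? ?] *.
by split; rewrite /ball /= ltr_norml; apply/andP; split; lra.
Unshelve. all: by end_near.
Qed.

Lemma connect_walk d (S : {set G}) u v : 0 < d -> u \in S -> connect (restr S) u v ->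
  exists c, [/\ path ustep (grid d (p u)) c, last (grid d (p u)) c = grid d (p v)
    & {in grid d (p u) :: c, forall x, traces d S x}].
Proof.
move=> d0 uS /connectP[g gp ->{v}]; elim: g u uS gp => [|w g IH] u uS /=.
  move=> _; exists [::]; split=> // x; rewrite inE => /eqP->; exists u, u; split=> //.
  by exists (p u); [rewrite /drawn adj_irr | exact: grid_shadows].
case/andP=> /and3P[_ wS uw] /(IH _ wS)[c [cp cl cn]].
have [_ /(_ _ _ uw)/arc_walk/(_ d0) [c' [cp' cl' cn']] _ _ _] := pa.
exists (c' ++ c); rewrite cat_path cp' cl' cp last_cat cl' cl; split=> // x.
rewrite -cat_cons mem_cat => /orP[/cn' xz|xc]; last by apply: cn; rewrite inE xc orbT.
by exists u, w; split=> //; rewrite /drawn uw.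
Qed.

Lemma grid_generic : injective (fun u => (p u).1) ->
  \forall d \near (0 : R)^'+, forall u v, u != v -> (grid d (p u)).1 != (grid d (p v)).1.
Proof.
move=> pI.
have H : \forall d \near (0 : R)^'+, forall q : G * G, q.1 != q.2 ->
    (grid d (p q.1)).1 != (grid d (p q.2)).1.
  apply: filter_forall => -[u v] /=; case: (eqVneq u v) => [->|uv]; first by near=> d => /eqP.
  have q0 : 0 < `|(p u).1 - (p v).1|.
    by rewrite normr_gt0 subr_eq0; apply: contraNneq uv => /pI->.
  near=> d => _; have d0 : 0 < d by [].
  apply/eqP => e; suff : `|(p u).1 - (p v).1| < 3 * d.
    apply/negP; rewrite -leNgt mulrC -ler_pdivlMr //; near: d.
    by apply: nbhs_right_le; rewrite divr_gt0.
  have := floor_close (p u).1 d0; have := floor_close (p v).1 d0; rewrite e.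
  by rewrite !ler_norml ltr_norml => /andP[? ?] /andP[? ?]; apply/andP; split; lra.
by apply: filterS H => d H u v uv; apply: (H (u, v)).
Unshelve. all: by end_near.
Qed.

End Drawing.

(** The walk for (i, j) runs anywhere in [A i :|: B j]. For i, k distinct and j, l distinct the sets
    [A i :|: B j] and [A k :|: B l] are disjoint, which is all that [no_lattice_K33] asks of two
    walks. *)
Theorem planar_K33_free : planar R G -> K33_free G.
Proof.
case/planar_generic => p [a [pa pI]] A B [cA cB dAB dA_B tAB].
near (0 : R)^'+ => d; have d0 : 0 < d by [].
have sep : forall (S T : {set G}) (v w : pt), [disjoint S & T]%B ->
    traces p a d S v -> traces p a d T w -> ~~ nearby 2 v w.
  by near: d; exact: traces_sep.
have gen : forall u v, u != v -> (grid d (p u)).1 != (grid d (p v)).1.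
  by near: d; exact: grid_generic.
have /choice[x xA] : forall i, exists x, x \in A i.
  by move=> i; have [/set0Pn] := cA i.
have /choice[y yB] : forall j, exists y, y \in B j.
  by move=> j; have [/set0Pn] := cB j.
have walk i j : exists c, [/\ path ustep (grid d (p (x i))) c,
    last (grid d (p (x i))) c = grid d (p (y j))
  & {in grid d (p (x i)) :: c, forall v, traces p a d (A i :|: B j) v}].
  apply: (connect_walk pa d0); first by rewrite inE xA.
  by apply: (connU (cA i) (cB j) (tAB i j)).2; rewrite inE ?xA ?yB ?orbT.
have /choice[c cP] : forall i, exists c : 'I_3 -> seq pt, forall j,
    [/\ path ustep (grid d (p (x i))) (c j),
    last (grid d (p (x i))) (c j) = grid d (p (y j))
  & {in grid d (p (x i)) :: c j, forall v, traces p a d (A i :|: B j) v}].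
  by move=> i; have [c cP] := choice (walk i); exists c.
apply: (@no_lattice_K33 (fun i => grid d (p (x i))) (fun j => grid d (p (y j))) c).
- by move=> i j; have [] := cP i j.
- by move=> i j; have [] := cP i j.
- move=> i j k l ik jl v w vc wc.
  apply: (sep (A i :|: B j) (A k :|: B l)); last 2 first.
  + by have [_ _] := cP i j; apply.
  + by have [_ _] := cP k l; apply.
  + have [[dA _] [_ dB]] := (dAB i k ik, dAB j l jl).
    rewrite -finset.setI_eq0 finset.setIUl !finset.setIUr !disjoint_setI0 ?finset.setU0 //.
    by rewrite disjoint_sym.
- move=> j l jl; apply: gen; apply: contraTneq (yB j) => ->.
  by have [_ dB] := dAB j l jl; rewrite (disjointFl dB).
- move=> i j; apply: gen; apply: contraTneq (xA i) => ->.
  by rewrite (disjointFl (dA_B i j)).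
Unshelve. all: by end_near.
Qed.

End Planar.

(** * Reversal and concatenation of arcs *)

Section Arcs.
Variable R : realType.
Implicit Types (f g : R -> R * R) (e d t : R) (a b : set (R * R)).

Lemma arc_rev a p q : is_arc a p q -> is_arc a q p.
Proof.
case=> f [/within01P cf fi f0 f1 ->]; exists (fun t => f (1 - t)); split.
- apply/within01P => x /in01 x01 e e0; have [|d d0 H] := cf (1 - x) _ e e0.
    by apply/in01; lra.
  exists d => // t /in01 t01 xt; apply: H; first by apply/in01; lra.
  by rewrite (_ : 1 - x - (1 - t) = t - x) ?(distrC t); lra.
- move=> s t; rewrite !inE => /in01 s01 /in01 t01 /fi e.
  have : 1 - s = 1 - t by apply: e; rewrite inE; apply/in01; lra.
  lra.
- by rewrite subr0.
- by rewrite subrr.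
- apply/seteqP; split=> z [t /in01 t01 <-]; exists (1 - t) => //; try (apply/in01; lra).
  by congr f; lra.
Qed.

Lemma arc_cat a b p q r : is_arc a p q -> is_arc b q r ->
  (forall z, a z -> b z -> z = q) -> is_arc (a `|` b) p r.
Proof.
case=> f [/within01P cf fi f0 f1 aE] [g [/within01P cg gi g0 g1 bE]] ab.
pose h t := if t <= 1 / 2 then f (2 * t) else g (2 * t - 1).
have fI s t : 0 <= s <= 1 -> 0 <= t <= 1 -> f s = f t -> s = t.
  by move=> s01 t01; apply: fi; rewrite inE; apply/in01.
have gI s t : 0 <= s <= 1 -> 0 <= t <= 1 -> g s = g t -> s = t.
  by move=> s01 t01; apply: gi; rewrite inE; apply/in01.
have hf t : t <= 1 / 2 -> h t = f (2 * t) by rewrite /h => ->.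
have hg t : 1 / 2 <= t -> h t = g (2 * t - 1).
  rewrite le_eqVlt => /predU1P[<-|lt]; last by rewrite /h leNgt lt.
  have e1 : 2 * (1 / 2) = 1 :> R by lra.
  by rewrite hf ?lexx // e1 subrr f1 g0.
have fa t : 0 <= t <= 1 -> a (f t) by move=> t01; rewrite aE; exists t => //; apply/in01.
have gb t : 0 <= t <= 1 -> b (g t) by move=> t01; rewrite bE; exists t => //; apply/in01.
have cross s t : 0 <= s <= 1 / 2 -> 1 / 2 < t <= 1 -> h s = h t -> False.
  move=> s0 t0; rewrite hf ?hg; [|lra|lra] => e.
  have gq : g (2 * t - 1) = q by apply: ab; [rewrite -e; apply: fa; lra | apply: gb; lra].
  by have : 2 * t - 1 = 0; [apply: gI; [lra|lra|rewrite gq g0] | lra].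
exists h; split.
- apply/within01P => x /in01 x01 e e0.
  have [d1 d10 H1] : exists2 d, 0 < d & forall t, 0 <= t <= 1 / 2 -> `|x - t| < d -> ball (h x) e (h t).
    have [x2|x2] := leP x (1 / 2); last first.
      by exists (x - 1 / 2) => [|t t0]; [lra | rewrite ltr_norml; lra].
    have [|d d0 H] := cf (2 * x) _ e e0; first by apply/in01; lra.
    exists (d / 2) => [|t t0 xt]; first lra.
    rewrite !hf //; last by case/andP: t0.
    by apply: H; [apply/in01; lra | move: xt; rewrite !ltr_norml; lra].
  have [d2 d20 H2] : exists2 d, 0 < d & forall t, 1 / 2 <= t <= 1 -> `|x - t| < d -> ball (h x) e (h t).
    have [x2|x2] := leP (1 / 2) x; last first.
      by exists (1 / 2 - x) => [|t t0]; [lra | rewrite ltr_norml; lra].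
    have [|d d0 H] := cg (2 * x - 1) _ e e0; first by apply/in01; lra.
    exists (d / 2) => [|t t0 xt]; first lra.
    rewrite !hg //; last by case/andP: t0.
    by apply: H; [apply/in01; lra | move: xt; rewrite !ltr_norml; lra].
  exists (Num.min d1 d2); first by rewrite lt_min d10.
  move=> t /in01 t01; rewrite lt_min => /andP[xt1 xt2].
  by have [t2|t2] := leP t (1 / 2); [apply: H1 => //; lra | apply: H2 => //; lra].
- move=> s t; rewrite !inE => /in01 s01 /in01 t01.
  have [s2|s2] := leP s (1 / 2); have [t2|t2] := leP t (1 / 2).
  + rewrite !hf // => /fI e; suff : 2 * s = 2 * t by lra.
    by apply: e; lra.
  + by move/cross => []; lra.
  + by move/esym/cross => []; lra.
  + rewrite !hg; [|lra|lra] => /gI e; suff : 2 * s - 1 = 2 * t - 1 by lra.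
    by apply: e; lra.
- by rewrite hf ?mulr0 //; lra.
- by rewrite hg; [rewrite mulr1 (_ : 2 - 1 = 1) //; lra | lra].
- rewrite aE bE; apply/seteqP; split=> z; last first.
    case=> t /in01 t01 <-; have [t2|t2] := leP t (1 / 2).
      by left; rewrite hf //; exists (2 * t) => //; apply/in01; lra.
    by right; rewrite hg; [exists (2 * t - 1) => //; apply/in01; lra | lra].
  case=> -[t /in01 t01 <-].
    exists (t / 2); first by apply/in01; lra.
    by rewrite hf; [congr f; lra | lra].
  exists ((t + 1) / 2); first by apply/in01; lra.
  by rewrite hg; [congr g; lra | lra].
Qed.

End Arcs.

(** * Planarity of subgraphs and drawing an additional edge *)

Section Embeddings.
Variable R : realType.

Lemma planar_embed (H G : sgraph) (f : H -> G) : injective f ->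
  (forall x y, adj x y -> adj (f x) (f y)) -> planar R G -> planar R H.
Proof.
move=> fI fadj [p [a [pI arc sym vtx edg]]].
exists (p \o f), (fun x y => a (f x) (f y)); split=> /=.
- by move=> x y /pI /fI.
- by move=> x y /fadj /arc.
- by move=> x y /fadj /sym.
- by move=> x y z /fadj xy; apply: vtx.
- move=> x y s t /fadj xy /fadj st n1 n2; apply: edg => // -[/fI e1 /fI e2].
    by apply: n1.
  by apply: n2.
Qed.

Section Reroute.
Variables (G : sgraph) (p : G -> R * R) (a : G -> G -> set (R * R)).
Hypothesis pa : plane_drawing p a.

Lemma arcs_meet x y s t z : adj x y -> adj s t ->
  ~ (x = s /\ y = t) -> ~ (x = t /\ y = s) -> a x y z -> a s t z ->
  exists w, [/\ z = p w, w = x \/ w = y & w = s \/ w = t].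
Proof.
have [pI arc sym vtx edg] := pa => xy st n1 n2 axy ast.
have ends u v u' v' : adj u v -> adj u' v' -> ~ (u = u' /\ v = v') -> ~ (u = v' /\ v = u') ->
    a u v z -> a u' v' z -> z = p u \/ z = p v.
  move=> uv uv' m1 m2 auv auv'; apply: contrapT => nz.
  suff : ((a u v `\` [set p u; p v]) `&` a u' v') z by rewrite edg.
  by split=> //; split.
have := ends _ _ _ _ xy st n1 n2 axy ast.
have : z = p s \/ z = p t.
  by apply: ends st xy _ _ ast axy => -[e1 e2]; [apply: n1 | apply: n2].
case=> zs [] zx.
- by exists x; split; [done | left | left; apply: pI; rewrite -zx].
- by exists y; split; [done | right | left; apply: pI; rewrite -zx].
- by exists x; split; [done | left | right; apply: pI; rewrite -zx].
- by exists y; split; [done | right | right; apply: pI; rewrite -zx].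
Qed.

Lemma path_arc (e : rel G) x c : subrel e (@adj G) -> path e x c -> uniq (x :: c) ->
  c != [::] -> exists b, is_arc b (p x) (p (last x c)) /\
    forall z, b z -> exists s t, [/\ s \in x :: c, t \in x :: c, e s t & a s t z].
Proof.
have [pI arc sym vtx edg] := pa => eadj; elim: c x => // y c IH x.
rewrite [path _ _ _]/= => /andP[xy yc] /andP[xnc uc] _.
have xyG := eadj _ _ xy.
have xyin : x \in x :: y :: c /\ y \in x :: y :: c by rewrite !inE !eqxx orbT.
case: c => [|w c] in IH yc xnc uc xyin *.
  exists (a x y); split; first exact: arc.
  by move=> z az; exists x, y; case: xyin.
have [//|b [bP bE]] := IH y yc uc.
exists (a x y `|` b); split.
  apply: (arc_cat (arc _ _ xyG) bP) => z az /bE[s [t [sc tc st ast]]].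
  have xs : x <> s by move=> e1; rewrite e1 sc in xnc.
  have xt : x <> t by move=> e1; rewrite e1 tc in xnc.
  have [||v [-> [vx|->//] []vs]] := arcs_meet xyG (eadj _ _ st) _ _ az ast; try by case.
    by case: xs; rewrite -vx.
  by case: xt; rewrite -vx.
move=> z [az|/bE[s [t [sc tc st ast]]]]; first by exists x, y; case: xyin.
by exists s, t; rewrite !(in_cons x) sc tc !orbT.
Qed.

End Reroute.

(* The additional edge uv is drawn along a path through D. *)
Lemma planar_add_edge (H G : sgraph) (f : H -> G) (D : {set G}) (u v : G) :
  injective f -> u != v ->
  (forall x y, adj x y -> [\/ adj (f x) (f y), f x = u /\ f y = v | f x = v /\ f y = u]) ->
  (forall x, f x \notin D) -> conn D -> u \in coboundary D -> v \in coboundary D ->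
  planar R G -> planar R H.
Proof.
move=> fI uv Hadj fD cD uD vD GP; have [auv|nuv] := boolP (adj u v).
  apply: (planar_embed fI) GP => x y /Hadj[//|[-> ->]//|[-> ->]].
  by rewrite adj_sym.
have [p [a pa]] := GP; have [pI arc sym vtx edg] := pa.
pose E := D :|: [set u; v]%SET.
have uE : u \in E by rewrite !inE eqxx orbT.
have vE : v \in E by rewrite !inE eqxx !orbT.
have touchE w : w \in coboundary D -> w \in E -> exists2 d, d \in D & adj w d.
  rewrite inE => /andP[_ /bigcupP[d dD]]; rewrite inE adj_sym => dw _; by exists d.
have [du duD udu] := touchE u uD uE; have [dv dvD vdv] := touchE v vD vE.
have DE : D \subset E by apply: finset.subsetUl.
have /connectP[c0 c0p c0v] : connect (restr E) u v.
  apply: (@connect_trans _ _ du); first exact: (connect_restr_adj uE (fintype.subsetP DE _ duD) udu).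
  apply: (@connect_trans _ _ dv); first exact: (connect_restrS DE (cD.2 _ _ duD dvD)).
  by rewrite restr_csym; apply: connect_restr_adj (fintype.subsetP DE _ dvD) vdv.
have [c [cp cu _ cv]] : exists c, [/\ path (restr E) u c, uniq (u :: c), True & v = last u c].
  by case/shortenP: c0p c0v => c cp cu _ cv; exists c.
have cN : c != [::] by apply: contraNneq uv => cN; rewrite cv cN.
have resadj : subrel (restr E) (@adj G) by move=> x y /and3P[].
have [b [bP bE]] := path_arc pa resadj cp cu cN; rewrite -cv in bP.
(* Since u and v are not adjacent, every edge inside [E] has an end in [D]. Hence it differs from
   all edges between images of [f], and shares at most u and v with them. *)
have {}bE z : b z -> exists s t, [/\ adj s t, s \in D \/ t \in D,
    forall w, w \notin D -> w = s \/ w = t -> w = u \/ w = v & a s t z].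
  case/bE=> s [t [_ _ /and3P[sE tE st] ast]]; exists s, t; split=> //.
- move: sE tE; rewrite !finset.in_setU !finset.in_set1; case: (s \in D); case: (t \in D) => /=; auto.
    by move=> /orP[]/eqP es /orP[]/eqP et; move: st nuv; rewrite es et ?adj_irr // adj_sym => ->.
  - move=> w wD ws; have : w \in E by case: ws => ->.
    by rewrite !finset.in_setU (negPf wD) !finset.in_set1 /= => /orP[]/eqP; auto.
pose a' x y := if adj (f x) (f y) then a (f x) (f y) else b.
have new x y : adj x y -> ~~ adj (f x) (f y) -> f x = u /\ f y = v \/ f x = v /\ f y = u.
  by move=> /Hadj[->//| |] *; [left | right].
have end_off x y z : adj x y -> ~~ adj (f x) (f y) -> forall w, w \notin D ->
    (w = u \/ w = v) -> z = p w -> [set p (f x); p (f y)] z.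
  by move=> xy nxy w wD wu ->; case: (new _ _ xy nxy) => -[-> ->]; case: wu => ->; by [left | right].
have inf x w : w = f x -> w \notin D by move=> ->.
exists (p \o f), a'; split=> /=.
- by move=> x y /pI /fI.
- move=> x y xy; rewrite /a'; case: ifPn => [/arc //|nxy].
  by case: (new _ _ xy nxy) => -[-> ->] //; apply: arc_rev.
- by move=> x y xy; rewrite /a' adj_sym; case: ifP => // /sym.
- move=> x y w xy; rewrite /a' /=; case: ifPn => [fxy|nxy]; first exact: vtx.
  case=> /bE[s [t [st _ stu ast]]]; apply.
  have fws : f w = s \/ f w = t.
    apply: contrapT => nw; apply: (vtx s t (f w) st); split=> // -[] /pI e;
    by apply: nw; rewrite e; auto.
  exact: (end_off x y _ xy nxy (f w) (fD w) (stu _ (fD w) fws) erefl).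
- move=> x y s t xy st n1 n2; rewrite /a'.
  have fn1 : ~ (f x = f s /\ f y = f t) by move=> [/fI e1 /fI e2]; apply: n1.
  have fn2 : ~ (f x = f t /\ f y = f s) by move=> [/fI e1 /fI e2]; apply: n2.
  rewrite -subset0; case: ifPn => [fxy|nxy]; case: ifPn => [fst|nst].
  + by move=> z; rewrite edg.
  + move=> z [[axy nz] /bE[s' [t' [st' D' _ ast']]]].
    have m (q : G) : q = f x \/ q = f y -> q \notin D by case=> ->.
    suff : ((a (f x) (f y) `\` [set p (f x); p (f y)]) `&` a s' t') z by rewrite edg //;
      move=> [e1 e2]; case: D' => D'; move: (D'); apply/negP; apply: m; rewrite -?e1 -?e2; auto.
    by [].
  + move=> z [[/bE[s' [t' [st' D' stu ast']]] nz] ast]; apply: nz.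
    have m (q : G) : q = f s \/ q = f t -> q \notin D by case=> ->.
    have [||w [zw ws wf]] := arcs_meet pa st' fst _ _ ast' ast.
    * by move=> [e1 e2]; case: D' => D'; move: (D'); apply/negP; apply: m; rewrite -?e1 -?e2; auto.
    * by move=> [e1 e2]; case: D' => D'; move: (D'); apply/negP; apply: m; rewrite -?e1 -?e2; auto.
    * exact: (end_off x y z xy nxy w (m w wf) (stu w (m w wf) ws) zw).
  + case: (new _ _ xy nxy) => -[ex ey]; case: (new _ _ st nst) => -[es et];
    by [case: fn1; rewrite ex ey es et | case: fn2; rewrite ex ey es et].
Qed.

End Embeddings.

End Drawings.

(** * Sparsity of K_{3,3}-minor-free graphs *)

Section Edges.
Variable I : finType.
Implicit Types (J K : {set I}) (F : rel I).

Definition deg J F x : nat := \sum_(y in J) F x y.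
(* Counts every edge twice. *)
Definition edges J F : nat := \sum_(x in J) deg J F x.

Lemma deg_card J F x : deg J F x = #|[set y in J | F x y]|.
Proof.
rewrite /deg -sum1_card big_mkcond /= [RHS]big_mkcond /=.
by apply: eq_bigr => y _; rewrite inE; case: (y \in J); case: (F x y).
Qed.

Lemma edgesD1 J F x : symmetric F -> irreflexive F -> x \in J ->
  edges J F = edges (J :\ x) F + 2 * deg (J :\ x) F x.
Proof.
move=> Fs Fi xJ; rewrite /edges (big_setD1 x) //=.
have degD1 y : deg J F y = F y x + deg (J :\ x) F y by rewrite /deg (big_setD1 x).
under eq_bigr => y _ do rewrite degD1 Fs.
by rewrite big_split /= degD1 Fi; rewrite -/(deg _ _ x); lia.
Qed.

(** [j] is merged into [i], without loops or parallel edges; [j] itself disappears by passing to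
    [J :\ j]. *)
Definition contract i j F : rel I :=
  [rel x y | [&& x != y & [|| F x y, (x == i) && F j y | (y == i) && F j x]]].

Lemma contract_sym i j F : symmetric F -> symmetric (contract i j F).
Proof.
by move=> Fs x y; rewrite /contract /= eq_sym (Fs x y) [X in _ || X]orbC.
Qed.

Lemma contract_irr i j F : irreflexive (contract i j F).
Proof. by move=> x; rewrite /contract /= eqxx. Qed.

(** The edge ij is lost, and one edge for every common neighbour of i and j; [edges] counts each of
    them twice. *)
Lemma edges_contract J F i j : symmetric F -> irreflexive F ->
  i \in J -> j \in J -> F i j ->
  edges J F = edges (J :\ j) (contract i j F) + 2 + 2 * \sum_(y in J) (F i y && F j y).
Proof.
move=> Fs Fi iJ jJ ij.
have ne : i != j by apply: contraTneq ij => ->; rewrite Fi.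
have iJj : i \in J :\ j by rewrite !inE ne.
rewrite (edgesD1 Fs Fi jJ) (edgesD1 Fs Fi iJj).
rewrite (edgesD1 (contract_sym i j Fs) (@contract_irr i j F) iJj).
set K := J :\ j :\ i.
have -> : deg (J :\ j) F j = 1 + deg K F j by rewrite /deg (big_setD1 i) //= Fs ij.
have -> : edges K (contract i j F) = edges K F.
  apply: eq_bigr => x; rewrite !inE => /andP[/negPf xi _].
  apply: eq_bigr => y; rewrite !inE => /andP[/negPf yi _].
  by rewrite /contract /= xi yi /= !orbF; case: eqP => // ->; rewrite Fi.
have -> : deg K (contract i j F) i = \sum_(y in K) (F i y || F j y).
  apply: eq_bigr => y; rewrite !inE => /andP[/negPf yi _].
  by rewrite /contract /= eqxx [i == y]eq_sym yi orbF.
have -> : \sum_(y in J) (F i y && F j y) = \sum_(y in K) (F i y && F j y).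
  by rewrite (big_setD1 j) //= (big_setD1 i) //= !Fi andbF.
have : deg K F i + deg K F j
    = \sum_(y in K) (F i y || F j y) + \sum_(y in K) (F i y && F j y).
  by rewrite -!big_split; apply: eq_bigr => y _; case: (F i y); case: (F j y).
lia.
Qed.

(* Each vertex is the centre of at least 6 * 5 ordered cherries, whereas common
   neighbourhoods of size at most 2 allow only 2 * (13 - 1) per vertex. *)
Lemma cherries J F : symmetric F -> irreflexive F -> 0 < #|J| <= 13 ->
  (forall w, w \in J -> 6 <= deg J F w) ->
  exists a b, [/\ a \in J, b \in J, a != b & 3 <= #|[set w in J | F a w && F b w]|].
Proof.
move=> Fs Fi /andP[J0 J13] deg6; pose com a b := #|[set w in J | F a w && F b w]|.
suff /exists_inP[a aJ /exists_inP[b bJ /andP[ab c3]]] :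
  [exists a in J, exists b in J, (a != b) && (3 <= com a b)] by exists a, b.
apply: contraT => /exists_inPn few.
have com2 a b : a \in J -> b \in J -> a != b -> com a b <= 2.
  move=> aJ bJ ab; have /exists_inPn/(_ b bJ) := few a aJ.
  by rewrite ab /= -ltnNge.
have : \sum_(w in J) deg J F w * deg J F w = \sum_(a in J) \sum_(b in J) com a b.
  under eq_bigr => w _ do rewrite {1}/deg big_distrl /=.
  rewrite exchange_big /=; apply: eq_bigr => a _.
  under eq_bigr => w _ do rewrite /deg big_distrr /=.
  rewrite exchange_big /=; apply: eq_bigr => b _.
  rewrite /com -sum1_card big_mkcond [RHS]big_mkcond /=; apply: eq_bigr => w _.
  by rewrite inE [F w a]Fs [F w b]Fs; case: (w \in J); case: (F a w); case: (F b w).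
have : \sum_(a in J) \sum_(b in J) com a b <= \sum_(a in J) (deg J F a + 2 * #|J|.-1).
  apply: leq_sum => a aJ; rewrite (big_setD1 a) //=; apply: leq_add.
    rewrite deg_card; apply: subset_leq_card; apply/subsetP => w.
    by rewrite !inE => /and3P[-> ->].
  have -> : #|J|.-1 = #|J :\ a| by rewrite (cardsD1 a J) aJ.
  rewrite mulnC -sum_nat_const; apply: leq_sum => b; rewrite !inE => /andP[ba bJ].
  by apply: com2 => //; rewrite eq_sym.
have : \sum_(w in J) (deg J F w + 30) <= \sum_(w in J) deg J F w * deg J F w.
  by apply: leq_sum => w /deg6; nia.
rewrite !big_split /= !sum_nat_const; nia.
Qed.

End Edges.

Section Density.
Variables (G : sgraph) (I : finType).
Hypothesis freeG : K33_free G.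
Implicit Types (J : {set I}) (P : I -> {set G}) (F : rel I).

Lemma ord3P (Q : 'I_3 -> Prop) : Q 0%R -> Q 1%R -> Q 2%R -> forall i, Q i.
Proof.
move=> Q0 Q1 Q2 [[|[|[|//]]] i3].
- by rewrite (_ : Ordinal i3 = 0%R) //; apply: val_inj.
- by rewrite (_ : Ordinal i3 = 1%R) //; apply: val_inj.
- by rewrite (_ : Ordinal i3 = 2%R) //; apply: val_inj.
Qed.

(** The graph [F] on [J] is a minor of [G] with branch sets [P]. Touching branch sets need not be
    linked by [F]. *)
Definition realized J P F : Prop :=
  [/\ {in J, forall i, conn (P i)},
      {in J &, forall i j, i != j -> [disjoint P i & P j]}
    & {in J &, forall i j, F i j -> touch (P i) (P j)}].

Lemma no_K33 J P F (s t : seq I) : realized J P F ->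
  3 <= size s -> 3 <= size t -> uniq (s ++ t) -> {subset s ++ t <= J} ->
  ~ {in s & t, forall i j, F i j}.
Proof.
case=> cP dP tP s3 t3 ust stJ st.
have x0 : I by case: s s3 {ust stJ st}.
have ins (i : 'I_3) : nth x0 s i \in s by rewrite mem_nth // (leq_trans (ltn_ord i)).
have int (i : 'I_3) : nth x0 t i \in t by rewrite mem_nth // (leq_trans (ltn_ord i)).
have sJ i : nth x0 s i \in s -> nth x0 s i \in J by move=> h; rewrite stJ // mem_cat h.
have tJ i : nth x0 t i \in t -> nth x0 t i \in J by move=> h; rewrite stJ // mem_cat h orbT.
move: ust; rewrite cat_uniq => /and3P[us /hasPn ts ut].
apply: (freeG (A := fun i : 'I_3 => P (nth x0 s i)) (B := fun i : 'I_3 => P (nth x0 t i))).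
split=> [i|i|i k ik|i j|i j].
- exact/cP/sJ.
- exact/cP/tJ.
- split; apply: dP; rewrite ?sJ ?tJ // nth_uniq ?(leq_trans (ltn_ord _)) //.
- apply: dP; rewrite ?sJ ?tJ //; apply: contraTneq (int j) => <-.
  by apply/negP => /ts; rewrite /= ins.
- by apply: tP; rewrite ?sJ ?tJ // st.
Qed.

Lemma realized_contract J P F i j : symmetric F -> irreflexive F -> realized J P F ->
  i \in J -> j \in J -> F i j ->
  realized (J :\ j) (fun x => if x == i then P i :|: P j else P x) (contract i j F).
Proof.
move=> Fs Fi [cP dP tP] iJ jJ ij.
have ne : i != j by apply: contraTneq ij => ->; rewrite Fi.
have tU A B C : touch A B -> @touch G (A :|: C) B.
  by case=> x [y [xA yB xy]]; exists x, y; rewrite inE xA.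
split=> [x|x y|x y]; rewrite !inE.
- by case/andP=> xj xJ; case: eqP => _; [apply: connU; auto | apply: cP].
- case/andP=> xj xJ /andP[yj yJ] xy.
  case: (eqVneq x i) => [xi|xi]; case: (eqVneq y i) => [yi|yi].
  + by rewrite xi yi eqxx in xy.
  + by rewrite -setI_eq0 setIUl !disjoint_setI0 ?setU0 ?eqxx // dP // eq_sym.
  + by rewrite -setI_eq0 setIUr !disjoint_setI0 ?setU0 ?eqxx // dP // eq_sym.
  + exact: dP.
- case/andP=> xj xJ /andP[yj yJ] /andP[xy].
  case: (eqVneq x i) xy => [->|xi]; case: (eqVneq y i) => [->|yi]; rewrite ?eqxx //= => _.
  + rewrite orbF; case/orP=> [iy|jy]; first exact/tU/tP.
    by rewrite setUC; apply/tU/tP.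
  + rewrite /=; case/orP=> [xi'|jx]; apply: touch_sym; first by apply/tU/tP; rewrite // Fs.
    by rewrite setUC; apply/tU/tP.
  + by rewrite orbF; apply: tP.
Qed.

Lemma realizedS J J' P F : J' \subset J -> realized J P F -> realized J' P F.
Proof.
move=> /subsetP s [cP dP tP]; split=> [x /s|x y /s xJ /s yJ|x y /s xJ /s yJ]; auto.
Qed.

(* Contracting an edge loses one more edge than there are triangles on it, so in a
   minimal counterexample every edge lies in six triangles.  The neighbourhood of a
   vertex of degree at most 13 then contains two vertices with three common
   neighbours, which gives a K_{3,3}. *)
Lemma density J P F : symmetric F -> irreflexive F -> realized J P F ->
  edges J F <= 12 * #|J|.
Proof.
have [n] := ubnP #|J|; elim: n J P F => // n IH J P F Jn Fs Fi rJ.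
rewrite leqNgt; apply/negP => dense.
have Fne x y : F x y -> x != y by apply: contraTneq => ->; rewrite Fi.
have smaller x : x \in J -> #|J :\ x| < n.
  by move=> xJ; move: Jn; rewrite (cardsD1 x J) xJ.
(* Deleting a vertex of degree at most 6 lowers [edges] by at most 12 and would leave a smaller
   counterexample. *)
have deg7 v : v \in J -> 6 < deg J F v.
  move=> vJ; have := IH (J :\ v) P F (smaller v vJ) Fs Fi (realizedS (subsetDl _ _) rJ).
  have -> : deg J F v = deg (J :\ v) F v by rewrite /deg (big_setD1 v) //= Fi.
  move: dense; rewrite (edgesD1 Fs Fi vJ) (cardsD1 v J) vJ; lia.
pose t i j := \sum_(y in J) (F i y && F j y).
(* The contracted graph has [edges] at most 12 (|J| - 1), and the contraction loses 2 + 2 t; the 10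
   is 12 - 2. *)
have tri i j : i \in J -> j \in J -> F i j -> 6 <= t i j /\ edges J F + 10 <= 12 * #|J| + 2 * t i j.
  move=> iJ jJ ij.
  have := IH _ _ _ (smaller j jJ) (contract_sym i j Fs) (@contract_irr _ i j F)
    (realized_contract Fs Fi rJ iJ jJ ij).
  move: dense; rewrite (edges_contract Fs Fi iJ jJ ij) (cardsD1 j J) jJ /t; lia.
(* The trivial bound t <= |J| turns [tri] into [edges J F] < 14 |J|, so the mean degree is below
   14. *)
have [v vJ v13] : exists2 v, v \in J & deg J F v <= 13.
  apply/exists_inP; apply: contraT => /exists_inPn big.
  have /set0Pn[i iJ] : J != set0.
    by apply: contraTneq dense => ->; rewrite /edges big_set0.
  have /card_gt0P[j] : 0 < #|[set y in J | F i y]|.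
    by rewrite -deg_card; apply: leq_trans _ (deg7 i iJ).
  rewrite inE => /andP[jJ ij]; have [_] := tri i j iJ jJ ij.
  have : t i j <= #|J|.
    by rewrite -sum1_card; apply: leq_sum => y _; case: (_ && _).
  have : \sum_(x in J) 14 <= edges J F by apply: leq_sum => x /big; rewrite -ltnNge.
  rewrite sum_nat_const; lia.
pose M := [set y in J | F v y].
have MJ w : w \in M -> (w \in J) && F v w by rewrite inE.
have M13 : 0 < #|M| <= 13 by rewrite -deg_card v13 andbT; apply: leq_trans _ (deg7 v vJ).
have M6 w : w \in M -> 6 <= deg M F w.
  case/MJ/andP=> wJ vw; have [+ _] := tri v w vJ wJ vw; move=> t6; apply: leq_trans t6 _.
  rewrite /t /deg big_mkcond [X in _ <= X]big_mkcond /=; apply: leq_sum => y _.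
  by rewrite inE; case: (y \in J); case: (F v y); case: (F w y).
have [a [b [aM bM ab]]] := cherries Fs Fi M13 M6.
set W := [set w in M | _] => W3.
apply: (no_K33 (s := [:: v; a; b]) (t := enum W) rJ) => //.
- by rewrite -cardE.
- have /andP[aJ va] := MJ a aM; have /andP[bJ vb] := MJ b bM.
  rewrite cat_uniq enum_uniq /= !inE negb_or (Fne v a) // (Fne v b) // ab /= andbT.
  apply/hasPn => w; rewrite mem_enum !inE => /and3P[/andP[_ vw] aw bw].
  by rewrite !negb_or ![w == _]eq_sym !Fne.
- move=> w; rewrite mem_cat mem_enum !inE => /orP[/or3P[]/eqP->//|/andP[/andP[]]//].
    by case/andP: (MJ a aM).
  by case/andP: (MJ b bM).
- move=> i j; rewrite mem_enum !inE => /or3P[]/eqP-> /andP[/andP[_ vj] /andP[aj bj]] //.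
Qed.

End Density.

(** * Klein-Plotkin-Rao decomposition *)

Lemma card_bigcup_leq (T I : finType) (J : {pred I}) (F : I -> {set T}) :
  #|\bigcup_(i in J) F i| <= \sum_(i in J) #|F i|.
Proof.
elim/big_rec2: _ => [|i m A _ IH]; first by rewrite cards0.
by apply: leq_trans (leq_card_setU _ _) _; rewrite leq_add2l.
Qed.

(** * Balls, breadth-first levels and chops *)

Section Balls.
Variable G : sgraph.
Implicit Types (U V S : {set G}) (x y z : G) (n m : nat).

Definition expand U S : {set G} := S :|: [set y | [exists x in S, restr U x y]].
Definition ball U n x : {set G} := iter n (expand U) [set x].

Lemma expandP U S y :
  reflect (y \in S \/ exists2 x, x \in S & restr U x y) (y \in expand U S).
Proof.
rewrite !inE; apply: (iffP orP) => -[yS|h]; [by left | right | by left | right].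
  by have /exists_inP[x xS xy] := h; exists x.
by have [x xS xy] := h; apply/exists_inP; exists x.
Qed.

Lemma ballP U n x y :
  reflect (y \in ball U n x \/ exists2 z, z \in ball U n x & restr U z y) (y \in ball U n.+1 x).
Proof. exact: expandP. Qed.

Lemma ball_step U n x y z : y \in ball U n x -> restr U y z -> z \in ball U n.+1 x.
Proof. by move=> yb yz; apply/ballP; right; exists y. Qed.

Lemma ball_center U n x : x \in ball U n x.
Proof. by elim: n => [|n IH]; [rewrite inE | apply/ballP; left]. Qed.

Lemma ball_sub U V n m x y :
  U \subset V -> n <= m -> y \in ball U n x -> y \in ball V m x.
Proof.
move=> UV; elim: m n y => [|m IH] n y; first by rewrite leqn0 => /eqP->.
case: n => [_|n nm]; first by move/set1P->; apply: ball_center.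
case/ballP => [|[z zb /and3P[zU yU zy]]]; first by move/(IH _ _ nm) => yb; apply/ballP; left.
by apply: ball_step (IH _ _ nm zb) _; rewrite /restr /= !(subsetP UV).
Qed.

Lemma ball_trans U n m x y z :
  y \in ball U n x -> z \in ball U m y -> z \in ball U (n + m) x.
Proof.
move=> yb; elim: m z => [|m IH] z; first by rewrite addn0 => /set1P->.
rewrite addnS => /ballP[/IH zb|[w /IH wb wz]]; apply/ballP; first by left.
by right; exists w.
Qed.

Lemma ball_sym U n x y : y \in ball U n x -> x \in ball U n y.
Proof.
elim: n y => [|n IH] y; first by move/set1P->; rewrite inE.
case/ballP => [/IH xb|[z /IH xz zy]]; first by apply/ballP; left.
rewrite -add1n; apply: ball_trans xz.
by apply: (@ball_step U 0 _ y); rewrite ?inE // restr_sym.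
Qed.

Lemma ball_connect U n x y : y \in ball U n x -> connect (restr U) x y.
Proof.
elim: n y => [|n IH] y; first by move/set1P->; apply: connect0.
case/ballP => [/IH //|[z /IH xz zy]]; apply: connect_trans xz _; exact: connect1.
Qed.

Lemma connect_ball U x y : connect (restr U) x y -> exists n, y \in ball U n x.
Proof.
case/connectP=> c + ->; elim/last_ind: c => [|c z IH]; first by exists 0; rewrite inE.
rewrite rcons_path last_rcons => /andP[/IH[n nb] cz]; exists n.+1.
exact: ball_step nb cz.
Qed.

Lemma ball_card U D n x : (forall y, y \in U -> degree y <= D) ->
  #|ball U n x| <= D.+1 ^ n.
Proof.
move=> degD; elim: n => [|n IH]; first by rewrite cards1.
have -> : ball U n.+1 x = expand U (ball U n x) by [].
have sub : expand U (ball U n x) \subset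
    \bigcup_(y in ball U n x) (y |: [set z | restr U y z]).
  apply/subsetP => z /expandP[zb|[y yb yz]]; apply/bigcupP.
    by exists z; rewrite ?setU11.
  by exists y; rewrite // !inE yz orbT.
apply: leq_trans (subset_leq_card sub) _.
apply: leq_trans (card_bigcup_leq _ _) _ => /=.
rewrite expnSr; apply: leq_trans (_ : #|ball U n x| * D.+1 <= _); last by rewrite leq_mul2r IH orbT.
rewrite -sum_nat_const; apply: leq_sum => y _.
apply: leq_trans (leq_card_setU _ _) _; rewrite cards1 add1n ltnS.
have [yU|yU] := boolP (y \in U); last first.
  by rewrite eq_card0 // => z; rewrite inE /restr /= (negPf yU).
apply: leq_trans (degD y yU); apply: subset_leq_card.
by apply/subsetP => z; rewrite !inE => /and3P[].
Qed.

(* The properties in use of the distance to a root chosen in each component. *)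
Definition levels U (l : G -> nat) : Prop :=
  [/\ forall x y, restr U x y -> l y <= l x + 1,
      forall x, x \in U -> 0 < l x -> exists2 y, restr U x y & l x = l y + 1
    & forall x y, x \in U -> connect (restr U) x y -> l x = 0 -> l y = 0 -> x = y].

Lemma levels_exist U : exists l, levels U l.
Proof.
pose r := fingraph.root (restr U).
have hasn x : exists n, x \in ball U n (r x).
  by apply: connect_ball; rewrite restr_csym connect_root.
pose l x := ex_minn (hasn x).
have lb x : x \in ball U (l x) (r x) by rewrite /l; case: ex_minnP.
have lmin x n : x \in ball U n (r x) -> l x <= n.
  by rewrite /l; case: ex_minnP => m _; apply.
have rr x y : connect (restr U) x y -> r x = r y by move/(fingraph.rootP (@restr_csym G U)).
have lip x y : restr U x y -> l y <= l x + 1.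
  move=> xy; apply: lmin; rewrite -(rr x y (connect1 xy)) addn1; exact: ball_step (lb x) xy.
exists l; split=> // [x xU lx|x y xU xy lx ly].
  have := lb x; case e : (l x) lx => [//|n] _ /ballP[xb|[y yb yx]].
    by have := lmin x n xb; rewrite e ltnn.
  have xy : restr U x y by rewrite restr_sym.
  exists y => //; rewrite addn1; congr _.+1; apply/eqP; rewrite eqn_leq.
  have := lip y x yx; rewrite e addn1 ltnS => -> /=.
  by apply: lmin; rewrite -(rr x y (connect1 xy)).
have := lb x; have := lb y; rewrite lx ly !inE => /eqP -> /eqP ->.
by apply: rr.
Qed.

Lemma ball_lip U l n x y : levels U l -> y \in ball U n x -> l y <= l x + n /\ l x <= l y + n.
Proof.
case=> lip _ _; elim: n y => [|n IH] y; first by move/set1P->; rewrite addn0.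
case/ballP => [/IH|[z /IH zb zy]]; first by lia.
have yz : restr U y z by rewrite restr_sym.
have := lip _ _ zy; have := lip _ _ yz; lia.
Qed.

(** [Q] is a shortest path from x towards the root, stopped at level m. The balls are restricted to
    the levels between y and x, so that the part of [Q] inside a band can be measured in the chopped
    set. *)
Lemma ascend U l m x : levels U l -> x \in U -> m <= l x ->
  exists Q : {set G}, [/\ x \in Q, Q \subset U, conn Q,
    forall k, m <= k <= l x -> exists2 z, z \in Q & l z = k
  & forall y, y \in Q -> m <= l y <= l x /\
      y \in ball [set w in U | l y <= l w <= l x] (l x - l y) x].
Proof.
move=> L; have [_ up _] := L; have [n] := ubnP (l x - m); elim: n x => // n IH x nx xU mx.
have [e|ne] := eqVneq m (l x).
  exists [set x]; split.
  - by rewrite inE.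
  - by rewrite sub1set.
  - exact: conn1.
  - by move=> k; rewrite e -eqn_leq => /eqP <-; exists x; rewrite ?inE.
  - by move=> y /set1P->; rewrite e !leqnn; split=> //; apply: ball_center.
have [|y xy lxy] := up x xU; first by lia.
have /and3P[_ yU axy] := xy.
have [||Q [yQ QU cQ lQ bQ]] := IH y _ yU; [lia|lia|].
exists (x |: Q); split.
- by rewrite setU11.
- by rewrite subUset sub1set xU.
- by apply: connU (conn1 x) cQ _; exists x, y; rewrite inE.
- move=> k mk; have [ekx|nk] := eqVneq k (l x); first by exists x; rewrite ?setU11.
  by have [|z zQ lz] := lQ k; [lia | exists z; rewrite // inE zQ orbT].
- move=> z /setU1P[->|/bQ[lz zb]].
    by split; [lia | rewrite subnn; apply: ball_center].
  split; first by lia.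
  have -> : l x - l z = 1 + (l y - l z) by lia.
  apply: (@ball_trans _ 1 _ _ y).
    apply: (@ball_step _ 0 _ x); rewrite ?inE // /restr /= !inE xU yU axy /=; lia.
  apply: ball_sub zb => //; apply/subsetP => w; rewrite !inE; lia.
Qed.

(** Every vertex of level at most m reaches the root of its component along decreasing levels, hence
    without leaving the set. *)
Lemma top_conn U l m x : levels U l -> x \in U ->
  (exists2 w, connect (restr U) x w & l w <= m) ->
  conn [set w | connect (restr U) x w & l w <= m].
Proof.
move=> L xU [w0 xw0 lw0]; set A := [set w | _ & _].
have AU w : w \in A -> w \in U.
  by rewrite inE => /andP[xw _]; apply: connect_restr_in xw xU.
have toroot w : w \in A -> exists r, [/\ r \in A, l r = 0 & connect (restr A) w r].
  move=> wA; have wU := AU w wA; move: (wA); rewrite inE => /andP[xw lw].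
  have [Q [wQ QU [_ cQ] lQ bQ]] := ascend L wU (leq0n (l w)).
  have QA : Q \subset A.
    apply/subsetP => y yQ; have [ly _] := bQ y yQ; rewrite inE; apply/andP; split; last by lia.
    by apply: connect_trans xw _; apply: connect_restrS QU _; apply: cQ.
  have [r rQ lr] := lQ 0 (leq0n _); exists r; split=> //; first exact: (subsetP QA).
  exact: connect_restrS QA (cQ _ _ wQ rQ).
have [_ _ L3] := L.
split; first by apply/set0Pn; exists w0; rewrite inE xw0.
move=> u v uA vA; have [r [rA lr ur]] := toroot u uA; have [s [sA ls vs]] := toroot v vA.
suff rs : r = s by rewrite (connect_trans ur) // rs restr_csym.
apply: L3 => //; first exact: AU.
by move: rA sA; rewrite !inE restr_csym => /andP[xr _] /andP[xs _]; apply: connect_trans xr xs.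
Qed.

Definition chop U (l : G -> nat) D c : {set G} := [set x in U | (l x + c) %% D != 0].

(** Averaging over D consecutive shifts: each vertex is deleted by at most one of them. *)
Lemma chop_exists U l D : 0 < D -> exists c, D * #|U :\: chop U l D c| <= #|U|.
Proof.
move=> D0; pose f (c : 'I_D) := #|U :\: chop U l D c|.
have : \sum_c f c <= #|U|.
  have fE c : f c = \sum_(x in U) ((l x + c) %% D == 0).
    rewrite /f -sum1_card big_mkcond [RHS]big_mkcond /=; apply: eq_bigr => x _.
    by rewrite !inE; case: (x \in U); case: eqP.
  under eq_bigr do rewrite fE; rewrite exchange_big /= -sum1_card.
  apply: leq_sum => x _.
  have -> : \sum_(c < D) ((l x + c) %% D == 0) = #|[set c : 'I_D | (l x + c) %% D == 0]|.
    by rewrite -sum1_card big_mkcond [RHS]big_mkcond /=; apply: eq_bigr => c _; rewrite inE; case: eqP.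
  apply/card_le1_eqP => c d; rewrite !inE => /eqP hc /eqP hd.
  apply: val_inj => /=; have : l x + c = l x + d %[mod D] by rewrite hc hd.
  by move/eqP; rewrite eqn_modDl !modn_small ?ltn_ord // => /eqP.
move=> sumf; have /existsP[c fc] : [exists c, D * f c <= #|U|]; last by exists c.
apply: contraT; rewrite negb_exists => /forallP big.
suff : D * #|U| < D * #|U| by rewrite ltnn.
apply: leq_trans (_ : \sum_(c < D) #|U|.+1 <= _); first by rewrite sum_nat_const card_ord ltn_pmul2l.
apply: leq_trans (_ : \sum_c D * f c <= _); first by apply: leq_sum => c _; rewrite ltnNge.
by rewrite -big_distrr leq_mul2l sumf orbT.
Qed.

(** Levels of adjacent vertices differ by at most one, so the quotient cannot change without passing
    through a deleted residue. *)
Lemma chop_band U l D c x y : 0 < D -> levels U l -> x \in chop U l D c ->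
  connect (restr (chop U l D c)) x y -> (l x + c) %/ D = (l y + c) %/ D.
Proof.
move=> D0 [lip _ _] + /connectP[p + ->]; elim: p x => //= z p IH x xC.
case/andP=> /and3P[_ zC xz] zp; rewrite -(IH z zC zp).
move: xC zC; rewrite !inE => /andP[xU xD] /andP[zU zD].
have xz1 : l z <= l x + 1 by apply: lip; rewrite /restr /= xU zU.
have zx1 : l x <= l z + 1 by apply: lip; rewrite /restr /= xU zU adj_sym.
have := divn_eq (l x + c) D; have := divn_eq (l z + c) D.
have := ltn_pmod (l x + c) D0; have := ltn_pmod (l z + c) D0; nia.
Qed.

Lemma band_close U l D c x y : 0 < D -> levels U l -> x \in chop U l D c ->
  connect (restr (chop U l D c)) x y -> l y < l x + D.
Proof.
move=> D0 L xC xy; have := chop_band D0 L xC xy.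
have := divn_eq (l x + c) D; have := divn_eq (l y + c) D.
have := ltn_pmod (l x + c) D0; have := ltn_pmod (l y + c) D0; nia.
Qed.

Lemma band U l D c x : 0 < D -> levels U l -> x \in chop U l D c -> D <= l x ->
  exists b, [/\ b < l x < b + D,
    forall y, connect (restr (chop U l D c)) x y -> b < l y < b + D
  & forall y, y \in U -> b < l y < b + D -> y \in chop U l D c].
Proof.
move=> D0 L xC Dx; set C := chop U l D c in xC *.
have [q qx] : exists q, (l x + c) %/ D = q by exists ((l x + c) %/ D).
have inband y : y \in C -> (l y + c) %/ D = q -> q * D < l y + c < q * D + D.
  rewrite inE => /andP[_ yD] yq; have := divn_eq (l y + c) D; rewrite yq.
  have := ltn_pmod (l y + c) D0; lia.
(* As [D <= l x], a deleted level lies between x and the root, and the difference [q * D - c] below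
   is not truncated. *)
have cq : c <= q * D by have := inband x xC qx; lia.
have shift k : (q * D < k + c < q * D + D) = (q * D - c < k < q * D - c + D) by lia.
exists (q * D - c); split.
- by rewrite -shift inband.
- move=> y xy; rewrite -shift inband //; first exact: connect_restr_in xy xC.
  by rewrite -qx (chop_band D0 L xC xy).
- move=> y yU; rewrite -shift inE yU /= => yb; apply/negP => /eqP y0.
  have ly : l y + c = (l y + c) %/ D * D by rewrite [LHS](divn_eq _ D) y0 addn0.
  move: yb; rewrite ly -mulSnr !ltn_pmul2r //; lia.
Qed.

End Balls.

(** * Components after three chops *)

Section Fragment.
Variable G : sgraph.
Hypothesis freeG : K33_free G.
Implicit Types (U V S : {set G}) (x y z : G) (n m : nat).

(** Otherwise all the x i have level at most 4D. They share a root, so two of them would be at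
    distance at most 8D. *)
Lemma near_root U l D c (x : 'I_3 -> G) : 0 < D -> levels U l ->
  (forall i, x i \in chop U l D c) ->
  (forall i j, connect (restr (chop U l D c)) (x i) (x j)) ->
  (forall i j, i != j -> x j \notin ball U (8 * D) (x i)) -> 3 * D <= l (x 0%R).
Proof.
move=> D0 L xC xx far; rewrite leqNgt; apply/negP => lx.
have CU : chop U l D c \subset U by apply/subsetP => z; rewrite inE => /andP[].
have small i : l (x i) <= 4 * D by have := band_close D0 L (xC 0%R) (xx 0%R i); lia.
have toroot i : exists2 r, r \in ball U (4 * D) (x i) & l r = 0 /\ r \in U.
  have xU := subsetP CU _ (xC i).
  have [Q [_ QU _ lQ bQ]] := ascend L xU (leq0n (l (x i))).
  have [r rQ lr] := lQ 0 (leq0n _); exists r; last by rewrite (subsetP QU).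
  have [_ rb] := bQ r rQ; apply: ball_sub rb; last by have := small i; lia.
  by apply/subsetP => w; rewrite inE => /andP[].
have [r rb [lr rU]] := toroot 0%R; have [s sb [ls sU]] := toroot 1%R.
have rs : r = s.
  have [_ _ L3] := L; apply: L3 => //.
  have h := connect_restrS CU (xx 0%R 1%R).
  rewrite (connect_trans _ (ball_connect sb)) // (connect_trans _ h) //.
  by rewrite restr_csym; apply: ball_connect rb.
have /negP := far 0%R 1%R isT; apply.
have -> : 8 * D = 4 * D + 4 * D by lia.
by apply: ball_trans rb _; rewrite rs; apply: ball_sym.
Qed.

Lemma touch_top U l m (Q : {set G}) z r : levels U l -> Q \subset U -> z \in Q -> l z = m.+1 ->
  connect (restr U) r z -> touch [set w | connect (restr U) r w & l w <= m] Q.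
Proof.
move=> [_ up _] QU zQ lz rz; have [||y zy ly] := up z; [exact: (subsetP QU) | by rewrite lz |].
have /and3P[_ _ azy] := zy; exists y, z; split=> //; last by rewrite adj_sym.
by rewrite inE (connect_trans rz (connect1 zy)); lia.
Qed.

(* One side of the K_{3,3} consists of the tops A1, A2, A3 of the three
   breadth-first searches, the other of three tails, one around each x i.  Within U3
   the branch of a tail towards A2 stays so close to x i that it avoids A3.  The
   branch towards A1 starts at a vertex u of the branch towards A2, midway between
   A2 and the band containing the component in U3, and thus avoids A2 and A3. *)
Lemma far_points_K33 U1 l1 c1 l2 c2 l3 c3 D (x : 'I_3 -> G) :
  let U2 := chop U1 l1 D c1 in let U3 := chop U2 l2 D c2 in let U4 := chop U3 l3 D c3 in
  0 < D -> levels U1 l1 -> levels U2 l2 -> levels U3 l3 ->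
  (forall i, x i \in U4) -> (forall i j, connect (restr U4) (x i) (x j)) ->
  ~ (forall i j, i != j -> x j \notin ball U1 (8 * D) (x i)).
Proof.
move=> U2 U3 U4 D0 L1 L2 L3 x4 xx4 far.
have U21 : U2 \subset U1 by apply/subsetP => z; rewrite inE => /andP[].
have U32 : U3 \subset U2 by apply/subsetP => z; rewrite inE => /andP[].
have U43 : U4 \subset U3 by apply/subsetP => z; rewrite inE => /andP[].
have U31 := subset_trans U32 U21.
have x3 i : x i \in U3 by apply: (subsetP U43).
have x2 i : x i \in U2 by apply: (subsetP U32).
have x1 i : x i \in U1 by apply: (subsetP U21).
have xx3 i j := connect_restrS U43 (xx4 i j).
have xx2 i j := connect_restrS U32 (xx3 i j).
have xx1 i j := connect_restrS U21 (xx2 i j).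
have far2 i j : i != j -> x j \notin ball U2 (8 * D) (x i).
  by move=> ij; apply: contra (far i j ij); apply: ball_sub.
have far3 i j : i != j -> x j \notin ball U3 (8 * D) (x i).
  by move=> ij; apply: contra (far i j ij); apply: ball_sub.
have h1 := near_root D0 L1 x2 xx2 far; have h2 := near_root D0 L2 x3 xx3 far2.
have h3 := near_root D0 L3 x4 xx4 far3.
have [|b1 [x0b1 comp1 in1]] := band D0 L1 (x2 0%R); first by move: h1; clear; lia.
have [|b2 [x0b2 comp2 in2]] := band D0 L2 (x3 0%R); first by move: h2; clear; lia.
have [|b3 [x0b3 comp3 _]] := band D0 L3 (x4 0%R); first by move: h3; clear; lia.
pose o := x 0%R.
pose T U (l : G -> nat) m := [set w | connect (restr U) o w & l w <= m].
(* The gap 2D below b2 leaves room for a vertex at level b2 - D whose ball of radius D - 1 in [U2]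
   stays above [A2] and below level b2, hence also off [A3]. The gap D below b3 keeps the balls of
   radius D around the x i in [U3] off [A3]. By [near_root] these differences are not truncated. *)
pose A1 := T U1 l1 b1; pose A2 := T U2 l2 (b2 - 2 * D); pose A3 := T U3 l3 (b3 - D).
have asc3 i : exists Q : {set G}, [/\ x i \in Q, Q \subset U3, conn Q, touch A3 Q
    & forall y, y \in Q -> b3 - D < l3 y /\ y \in ball U1 (4 * D) (x i)].
  have bi := comp3 _ (xx4 0%R i).
  have [|Q [xQ QU cQ lQ bQ]] := @ascend _ U3 l3 (b3 - D).+1 (x i) L3 (x3 i); first by move: D0 h1 h2 h3 x0b1 x0b2 x0b3 bi; clear; lia.
  exists Q; split=> // [|y yQ].
    have [|z zQ lz] := lQ (b3 - D).+1; first by move: D0 h1 h2 h3 x0b1 x0b2 x0b3 bi; clear; lia.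
    apply: (touch_top L3 QU zQ lz); apply: connect_trans (xx3 0%R i) _.
    by apply: connect_restrS QU _; apply: cQ.2.
  have [ly yb] := bQ y yQ; split; first by move: ly; clear; lia.
  apply: ball_sub yb; last by move: D0 h1 h2 h3 x0b1 x0b2 x0b3 bi ly; clear; lia.
  by apply: subset_trans U31; apply/subsetP => w; rewrite inE => /andP[].
have asc2 i : exists Q : {set G}, [/\ x i \in Q, Q \subset U2, conn Q, touch A2 Q
    & (exists2 u, u \in Q & l2 u = b2 - D) /\
      forall y, y \in Q -> [/\ b2 - 2 * D < l2 y, y \in ball U1 (3 * D) (x i)
         & b2 < l2 y -> y \in ball U3 D (x i)]].
  have bi := comp2 _ (xx3 0%R i).
  have [|Q [xQ QU cQ lQ bQ]] := @ascend _ U2 l2 (b2 - 2 * D).+1 (x i) L2 (x2 i); first by move: D0 h1 h2 h3 x0b1 x0b2 x0b3 bi; clear; lia.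
  exists Q; split=> //.
    have [|z zQ lz] := lQ (b2 - 2 * D).+1; first by move: D0 h1 h2 h3 x0b1 x0b2 x0b3 bi; clear; lia.
    apply: (touch_top L2 QU zQ lz); apply: connect_trans (xx2 0%R i) _.
    by apply: connect_restrS QU _; apply: cQ.2.
  split; first by apply: lQ; move: D0 h1 h2 h3 x0b1 x0b2 x0b3 bi; clear; lia.
  move=> y yQ; have [ly yb] := bQ y yQ; split; first by move: ly; clear; lia.
    apply: ball_sub yb; last by move: D0 h1 h2 h3 x0b1 x0b2 x0b3 bi ly; clear; lia.
    by apply: subset_trans U21; apply/subsetP => w; rewrite inE => /andP[].
  move=> by2; apply: ball_sub yb; last by move: by2 bi; clear; lia.
  by apply/subsetP => w; rewrite inE => /andP[wU lw]; apply: in2 => //; move: by2 bi lw; clear; lia.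
have asc1 u : u \in U2 -> connect (restr U2) o u -> exists Q : {set G},
    [/\ u \in Q, Q \subset U1, conn Q, touch A1 Q
    & forall y, y \in Q -> b1 < l1 y /\ y \in ball U2 D.-1 u].
  move=> uU ou; have bi := comp1 _ ou.
  have [|Q [xQ QU cQ lQ bQ]] := @ascend _ U1 l1 b1.+1 u L1 (subsetP U21 _ uU); first by move: D0 h1 h2 h3 x0b1 x0b2 x0b3 bi; clear; lia.
  exists Q; split=> //.
    have [|z zQ lz] := lQ b1.+1; first by move: D0 h1 h2 h3 x0b1 x0b2 x0b3 bi; clear; lia.
    apply: (touch_top L1 QU zQ lz); apply: connect_trans (connect_restrS U21 ou) _.
    by apply: connect_restrS QU _; apply: cQ.2.
  move=> y yQ; have [ly yb] := bQ y yQ; split; first by move: ly; clear; lia.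
  apply: ball_sub yb; last by move: D0 h1 h2 h3 x0b1 x0b2 x0b3 bi ly; clear; lia.
  by apply/subsetP => w; rewrite inE => /andP[wU lw]; apply: in1 => //; move: ly bi lw; clear; lia.
have A2U y : y \in A2 -> connect (restr U2) o y /\ l2 y <= b2 - 2 * D.
  by rewrite inE => /andP[].
have A3U y : y \in A3 -> connect (restr U3) o y /\ l3 y <= b3 - D.
  by rewrite inE => /andP[].
have A1U y : y \in A1 -> l1 y <= b1 by rewrite inE => /andP[].
have tail i : exists B : {set G}, [/\ conn B, touch A1 B, touch A2 B, touch A3 B
    & forall y, y \in B -> [/\ y \notin A1, y \notin A2, y \notin A3 & y \in ball U1 (4 * D) (x i)]].
  have [Q3 [xQ3 Q3U cQ3 tQ3 bQ3]] := asc3 i.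
  have [Q2 [xQ2 Q2U cQ2 tQ2 [[u uQ2 lu] bQ2]]] := asc2 i.
  have xu : connect (restr U2) (x i) u by apply: connect_restrS Q2U _; apply: cQ2.2.
  have [||Q1 [uQ1 Q1U cQ1 tQ1 bQ1]] := asc1 u; first exact: (subsetP Q2U).
    exact: connect_trans (xx2 0%R i) xu.
  have oQ2 y : y \in Q2 -> connect (restr U2) o y.
    by move=> yQ; apply: connect_trans (xx2 0%R i) _; apply: connect_restrS Q2U _; apply: cQ2.2.
  have oQ3 y : y \in Q3 -> connect (restr U3) o y.
    by move=> yQ; apply: connect_trans (xx3 0%R i) _; apply: connect_restrS Q3U _; apply: cQ3.2.
  exists (Q3 :|: Q2 :|: Q1); split.
  - apply: (@conn_meet _ _ _ u) => //; last by rewrite inE uQ2 orbT.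
    exact: (@conn_meet _ _ _ (x i)).
  - by apply: touchS tQ1 => //; apply: subsetUr.
  - by apply: touchS tQ2 => //; apply: subset_trans (subsetUl _ _); apply: subsetUr.
  - by apply: touchS tQ3 => //; apply: subset_trans (subsetUl _ _); apply: subsetUl.
  move=> y /setUP[/setUP[]|] yQ.
  - have [ly yb] := bQ3 y yQ; have oy3 := oQ3 y yQ; have oy2 := connect_restrS U32 oy3.
    split; [apply/negP | apply/negP | apply/negP | by []].
    + by move/A1U; have := comp1 _ oy2; clear; lia.
    + by case/A2U=> _; have := comp2 _ oy3; clear; lia.
    + by case/A3U=> _; move: ly; clear; lia.
  - have [ly yb y3] := bQ2 y yQ; have oy2 := oQ2 y yQ.
    split; [apply/negP | apply/negP | apply/negP |].
    + by move/A1U; have := comp1 _ oy2; clear; lia.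
    + by case/A2U=> _; move: ly; clear; lia.
    + case/A3U=> oy3; have := comp2 _ oy3; have := comp3 _ (xx4 0%R i).
      move=> + /andP[/y3/(ball_lip L3)[_ +] _]; move: h3 x0b3; clear; lia.
    + by apply: ball_sub yb => //; clear; lia.
  - have [ly yb] := bQ1 y yQ; have [_ ub _] := bQ2 u uQ2.
    have [] := ball_lip L2 yb; rewrite lu => ly1 ly2.
    split; [apply/negP | apply/negP | apply/negP |].
    + by move/A1U; move: ly; clear; lia.
    + by case/A2U=> _; move: ly1 ly2 h2 x0b2 D0; clear; lia.
    + by case/A3U=> /comp2; move: ly1 ly2 h2 x0b2 D0; clear; lia.
    + have -> : 4 * D = 3 * D + D by clear; lia.
      by apply: ball_trans ub _; apply: ball_sub yb => //; exact: leq_pred.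
have [B BP] := fin_all_exists tail.
pose A i := nth A1 [:: A1; A2; A3] (nat_of_ord (i : 'I_3)).
have A2c1 y : y \in A2 -> b1 < l1 y.
  by case/A2U=> /comp1 + _; clear; lia.
have A3c1 y : y \in A3 -> b1 < l1 y.
  by case/A3U=> /(connect_restrS U32)/comp1 + _; clear; lia.
have A3c2 y : y \in A3 -> b2 < l2 y.
  by case/A3U=> /comp2 + _; clear; lia.
have d12 : [disjoint A1 & A2].
  by apply: disjoint_notin => y /A1U; apply: contraL => /A2c1; clear; lia.
have d13 : [disjoint A1 & A3].
  by apply: disjoint_notin => y /A1U; apply: contraL => /A3c1; clear; lia.
have d23 : [disjoint A2 & A3].
  by apply: disjoint_notin => y /A2U[_]; apply: contraL => /A3c2; clear; lia.
have [_ [w1 [? [w1A _ _]]] [w2 [? [w2A _ _]]] [w3 [? [w3A _ _]]] _] := BP 0%R.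
have cA1 : conn A1.
  by apply: top_conn L1 (x1 0%R) _; move: w1A; rewrite inE => /andP[? ?]; exists w1.
have cA2 : conn A2.
  by apply: top_conn L2 (x2 0%R) _; move: w2A; rewrite inE => /andP[? ?]; exists w2.
have cA3 : conn A3.
  by apply: top_conn L3 (x3 0%R) _; move: w3A; rewrite inE => /andP[? ?]; exists w3.
apply: (freeG (A := A) (B := B)); split.
- by apply: ord3P.
- by move=> i; have [] := BP i.
- move=> i k ik; split.
    move: i k ik; apply: ord3P; apply: ord3P => //=; rewrite /A //= => _;
    by rewrite // disjoint_sym.
  apply: disjoint_notin => y yi; apply: contra (far i k ik) => yk.
  have [_ _ _ _ /(_ y yi)[_ _ _ yb]] := BP i; have [_ _ _ _ /(_ y yk)[_ _ _ yb']] := BP k.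
  have -> : 8 * D = 4 * D + 4 * D by clear; lia.
  by apply: ball_trans yb _; apply: ball_sym.
- move=> i j; rewrite disjoint_sym; apply: disjoint_notin => y yj.
  have [_ _ _ _ /(_ y yj)[? ? ? _]] := BP j; by move: i; apply: ord3P.
- by move=> i j; have [_ t1 t2 t3 _] := BP j; move: i; apply: ord3P.
Qed.

Lemma connect_leaves U S x y : connect (restr U) x y -> x \in S -> y \notin S ->
  exists u v, [/\ u \in S, v \notin S, restr U u v & connect (restr U) x v].
Proof.
case/connectP=> p + ->; elim: p x => [|z p IH] x /=; first by move=> _ ->.
case/andP=> xz zp xS yS; have [zS|zS] := boolP (z \in S); last first.
  by exists x, z; split=> //; apply: connect1.
have [u [v [uS vS uv zv]]] := IH z zp zS yS; exists u, v; split=> //.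
exact: connect_trans (connect1 xz) zv.
Qed.

(** If y were farther away, a walk from x to y in [U4] would leave the ball of radius 8D around x at
    some z. Then z is at distance at most 8D + 1 from x, hence more than 8D from y, because (8D + 1)
    + 8D <= 17D. So x, z, y contradict [far_points_K33]. *)
Lemma fragment_ball U1 l1 c1 l2 c2 l3 c3 D x y :
  let U2 := chop U1 l1 D c1 in let U3 := chop U2 l2 D c2 in let U4 := chop U3 l3 D c3 in
  0 < D -> levels U1 l1 -> levels U2 l2 -> levels U3 l3 ->
  x \in U4 -> connect (restr U4) x y -> y \in ball U1 (17 * D) x.
Proof.
move=> U2 U3 U4 D0 L1 L2 L3 x4 xy; apply: contraT => far.
have U41 : U4 \subset U1 by apply/subsetP => w; rewrite !inE => /andP[/andP[/andP[]]].
have y8 : y \notin ball U1 (8 * D) x.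
  by apply: contra far; apply: ball_sub => //; rewrite leq_mul2r orbT.
have [u [z [u8 z8 uz xz]]] := connect_leaves xy (ball_center U1 (8 * D) x) y8.
have zb : z \in ball U1 (8 * D).+1 x.
  apply: ball_step u8 _; case/and3P: uz => uU zU uz.
  by rewrite /restr /= !(subsetP U41).
have yz : y \notin ball U1 (8 * D) z.
  apply: contra far => yz; apply: ball_sub (ball_trans zb yz) => //.
  by move: D0; clear; lia.
have zy : connect (restr U4) z y by apply: connect_trans xy; rewrite restr_csym.
pose f i := nth x [:: x; z; y] (nat_of_ord (i : 'I_3)).
case: (@far_points_K33 U1 l1 c1 l2 c2 l3 c3 D f D0 L1 L2 L3).
- by apply: ord3P => //; [exact: connect_restr_in xz x4 | exact: connect_restr_in xy x4].
- by apply: ord3P; apply: ord3P; rewrite /f /= ?connect0 // restr_csym.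
- have sw n a b : b \notin ball U1 n a -> a \notin ball U1 n b.
    by apply: contra; apply: ball_sym.
  by apply: ord3P; apply: ord3P => //= _; rewrite /f //=; apply: sw.
Qed.

(** Each chop deletes a fraction 1/D. Distances measured in [U1] instead of [U4] suffice, since the
    degree bound on [U1] limits the size of its balls. *)
Lemma fragment U1 dg D : 0 < D -> (forall y, y \in U1 -> degree y <= dg) ->
  exists U4 : {set G}, [/\ U4 \subset U1, D * #|U1 :\: U4| <= 3 * #|U1|
    & forall x, x \in U4 -> #|[set y | connect (restr U4) x y]| <= dg.+1 ^ (17 * D)].
Proof.
move=> D0 degU.
have [l1 L1] := levels_exist U1; have [c1 C1] := chop_exists U1 l1 D0.
set U2 := chop U1 l1 D c1 in C1.
have [l2 L2] := levels_exist U2; have [c2 C2] := chop_exists U2 l2 D0.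
set U3 := chop U2 l2 D c2 in C2.
have [l3 L3] := levels_exist U3; have [c3 C3] := chop_exists U3 l3 D0.
set U4 := chop U3 l3 D c3 in C3.
have U21 : U2 \subset U1 by apply/subsetP => z; rewrite inE => /andP[].
have U32 : U3 \subset U2 by apply/subsetP => z; rewrite inE => /andP[].
have U43 : U4 \subset U3 by apply/subsetP => z; rewrite inE => /andP[].
have U41 := subset_trans U43 (subset_trans U32 U21).
exists U4; split=> // [|x x4].
  have cD (A B : {set G}) : B \subset A -> #|A| = #|B| + #|A :\: B|.
    by move=> BA; rewrite -(cardsID B A) (setIidPr BA).
  have := cD _ _ U21; have := cD _ _ U32; have := cD _ _ U43; have := cD _ _ U41.
  by move: C1 C2 C3; clear; nia.
apply: leq_trans (ball_card _ _ degU); apply: subset_leq_card; apply/subsetP => y.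
by rewrite inE; apply: (@fragment_ball U1 l1 c1 l2 c2 l3 c3).
Qed.

End Fragment.

(** * Total coboundary of attached sets *)

Section Count.
Variable G : sgraph.
Hypothesis freeG : K33_free G.
Implicit Types (A K : {set G}) (x y z : G).
Implicit Types (U : {set {set G}}) (h : {ffun {set G} -> G * G}).

Lemma coboundaryP A y :
  reflect (y \notin A /\ exists2 v, v \in A & adj v y) (y \in coboundary A).
Proof.
rewrite inE; apply: (iffP andP) => [[-> /bigcupP[v vA vy]]|[-> [v vA vy]]]; split=> //.
  by exists v => //; rewrite inE in vy.
by apply/bigcupP; exists v; rewrite ?inE.
Qed.

Lemma conn_star x (S : {set {set G}}) :
  (forall K, K \in S -> conn K /\ touch [set x] K) -> conn (x |: \bigcup_(K in S) K).
Proof.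
move=> star; set B := _ |: _; have xB : x \in B by rewrite setU11.
split; first by apply/set0Pn; exists x.
have tox z : z \in B -> connect (restr B) z x.
  case/setU1P=> [->//|/bigcupP[K KS zK]]; have [[_ cK] [_ [k [/set1P-> kK xk]]]] := star K KS.
  have KB : K \subset B by apply: subset_trans (subsetUr _ _); apply: bigcup_sup.
  apply: connect_trans (connect_restrS KB (cK _ _ zK kK)) _.
  by apply: connect_restr_adj => //; [exact: (subsetP KB) | rewrite adj_sym].
by move=> u v /tox ux /tox vx; rewrite (connect_trans ux) // restr_csym.
Qed.

Variables (X : {set G}) (KK : {set {set G}}).
Hypotheses (connK : forall K, K \in KK -> conn K)
  (disjK : {in KK &, forall K L, K != L -> [disjoint K & L]})
  (disjX : forall K, K \in KK -> [disjoint K & X])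
  (cobX : forall K, K \in KK -> coboundary K \subset X).

(** Three members of [S] would form a K_{3,3} together with the single vertices x, y, z. *)
Lemma common_coboundary x y z (S : {set {set G}}) : S \subset KK ->
  x != y -> x != z -> y != z ->
  (forall K, K \in S -> [&& x \in coboundary K, y \in coboundary K & z \in coboundary K]) ->
  #|S| <= 2.
Proof.
move=> /subsetP SK xy xz yz xyzS; rewrite leqNgt; apply/negP => S3.
have inS (i : 'I_3) : nth set0 (enum S) i \in S.
  by rewrite -mem_enum mem_nth // -cardE (leq_trans (ltn_ord i)).
have inX a (i : 'I_3) : a \in coboundary (nth set0 (enum S) i) -> a \in X.
  by apply/subsetP/cobX/SK.
have cob a (i : 'I_3) : a \in coboundary (nth set0 (enum S) i) ->
    touch [set a] (nth set0 (enum S) i).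
  by case/coboundaryP=> _ [v vK va]; exists a, v; rewrite inE adj_sym.
apply: (freeG (A := fun i : 'I_3 => [set nth x [:: x; y; z] i])
              (B := fun i : 'I_3 => nth set0 (enum S) i)).
have cobs (i j : 'I_3) : nth x [:: x; y; z] i \in coboundary (nth set0 (enum S) j).
  by have /and3P[? ? ?] := xyzS _ (inS j); move: i; apply: ord3P.
split.
- by move=> i; apply: conn1.
- by move=> i; apply/connK/SK.
- move=> i k ik; split; last first.
    apply: disjK; rewrite ?SK // nth_uniq ?enum_uniq // -cardE;
    exact: leq_trans (ltn_ord _) S3.
  rewrite disjoints1 inE nth_uniq // /= !inE negb_or xy xz yz //=.
- move=> i j; rewrite disjoints1.
  by have := disjX (SK _ (inS j)); rewrite disjoint_sym => /disjointFr ->; rewrite // (inX _ j).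
- by move=> i j; apply: cob.
Qed.

(* [h] gives each member of [U] a pair of distinct vertices of its coboundary, and
   no unordered pair twice.  Contracting each member onto the first vertex of its
   pair realizes [link U h] as a minor. *)
Definition link (U : {set {set G}}) (h : {ffun {set G} -> G * G}) : rel G :=
  [rel x y | [exists K in U, (h K == (x, y)) || (h K == (y, x))]].

Definition linking (U : {set {set G}}) (h : {ffun {set G} -> G * G}) : bool :=
  [forall K in U, [&& K \in KK, (h K).1 \in coboundary K, (h K).2 \in coboundary K
     & (h K).1 != (h K).2]] &&
  [forall K in U, forall L in U, (K != L) ==> (h K != h L) && (h K != ((h L).2, (h L).1))].

Lemma linkP U h x y :
  reflect (exists2 K, K \in U & h K = (x, y) \/ h K = (y, x)) (link U h x y).
Proof.
apply: (iffP exists_inP) => -[K KU hK]; exists K => //.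
  by case/orP: hK => /eqP; [left | right].
by case: hK => ->; rewrite eqxx ?orbT.
Qed.

Lemma link_sym U h : symmetric (link U h).
Proof.
by move=> x y; apply/linkP/linkP => -[K KU []]; exists K; auto.
Qed.

Section Linking.
Variables (U : {set {set G}}) (h : {ffun {set G} -> G * G}).
Hypothesis lUh : linking U h.

Lemma linkingP K : K \in U -> [/\ K \in KK, (h K).1 \in coboundary K,
   (h K).2 \in coboundary K & (h K).1 != (h K).2].
Proof. by case/andP: lUh => /forall_inP H _ /H/and4P[]. Qed.

Lemma link_irr : irreflexive (link U h).
Proof.
move=> x; apply/linkP => -[K KU hK]; have [_ _ _ /eqP] := linkingP KU.
by case: hK => ->.
Qed.

Lemma link_realized (J : {set G}) : J \subset X ->
  realized J (fun x => x |: \bigcup_(K in [set K in U | (h K).1 == x]) K) (link U h).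
Proof.
move=> /subsetP JX; set P := fun x => _.
have xP x : x \in P x by rewrite setU11.
have KP K : K \in U -> K \subset P (h K).1.
  move=> KU; apply: subset_trans (subsetUr _ _).
  by apply: (bigcup_sup K); rewrite inE KU eqxx.
have touchP x y K : K \in U -> h K = (x, y) -> touch (P x) (P y).
  move=> KU hK; have [_ _ + _] := linkingP KU; rewrite hK => /coboundaryP[_ [v vK vy]].
  by exists v, y; split=> //; move/subsetP: (KP K KU); rewrite hK; apply.
split.
- move=> x _; apply: conn_star => K; rewrite inE => /andP[KU /eqP <-].
  have [KK' /coboundaryP[_ [v vK vh]] _ _] := linkingP KU; split; first exact: connK.
  by exists (h K).1, v; rewrite inE adj_sym.
- move=> x y xJ yJ xy; apply: disjoint_notin => w wx; apply: contra xy => wy.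
  have notX K a : K \in U -> a \in J -> a \notin K.
    move=> KU aJ; have [/disjX + _ _ _] := linkingP KU; rewrite disjoint_sym.
    by move/disjointFr => -> //; apply: JX.
  move: wx wy; rewrite !inE => /orP[/eqP->|/bigcupP[K + wK]] /orP[|/bigcupP[L + wL]] //.
  + by rewrite inE => /andP[LU _]; rewrite (negPf (notX L x LU xJ)) in wL.
  + by rewrite inE => /andP[KU _] /eqP wy; rewrite wy (negPf (notX K y KU yJ)) in wK.
  + rewrite !inE => /andP[KU /eqP <-] /andP[LU /eqP <-].
    have [/= KK1 _ _ _] := linkingP KU; have [KK2 _ _ _] := linkingP LU.
    case: (eqVneq K L) => [->//|KL]; have := disjK KK1 KK2 KL.
    by move/disjointFr => /(_ w wK); rewrite wL.
- move=> x y _ _ /linkP[K KU []] hK; first exact: touchP hK.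
  by apply: touch_sym; apply: touchP hK.
Qed.

Lemma link_density (J : {set G}) : J \subset X -> edges J (link U h) <= 12 * #|J|.
Proof.
by move=> JX; apply: (density freeG (@link_sym U h) link_irr (link_realized JX)).
Qed.

Lemma card_linking : #|U| <= 12 * #|X|.
Proof.
apply: leq_trans (link_density (subxx X)).
have -> : edges X (link U h) = #|[set p : G * G | [&& p.1 \in X, p.2 \in X & link U h p.1 p.2]]|.
  rewrite /edges /deg pair_big /= -sum1_card big_mkcond [RHS]big_mkcond /=.
  by apply: eq_bigr => p _; rewrite inE; case: (p.1 \in X); case: (p.2 \in X); case: (link _ _ _ _).
have hI : {in U &, injective h}.
  move=> K L KU LU hKL; apply/eqP/negPn/negP => KL.
  case/andP: lUh => _ /forall_inP/(_ K KU)/forall_inP/(_ L LU); rewrite KL /= hKL eqxx //.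
rewrite -(card_in_imset hI); apply: subset_leq_card; apply/subsetP => p /imsetP[K KU ->].
have [KK1 h1 h2 _] := linkingP KU; rewrite inE !(subsetP (cobX KK1)) //=.
by apply/linkP; exists K => //; left; apply: surjective_pairing.
Qed.

End Linking.

Hypothesis cob2 : forall K, K \in KK -> 2 <= #|coboundary K|.
Hypothesis uniq2 : {in KK &, forall K L, #|coboundary K| = 2 ->
  coboundary K = coboundary L -> K = L}.

(** A linking with the largest number of members: a set outside it with an unlinked pair in its
    coboundary could be added with that pair. Thus the coboundaries of the remaining sets are
    cliques of a sparse graph. *)
Lemma maximal_linking (x0 : G) : exists U h, linking U h /\
  forall K, K \in KK -> K \notin U -> {in coboundary K &, forall x y, x != y -> link U h x y}.
Proof.
pose P n := [exists U : {set {set G}}, exists h, linking U h && (#|U| == n)].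
have P0 : exists n, P n.
  exists 0; apply/existsP; exists set0; apply/existsP.
  exists [ffun=> (x0, x0)]; rewrite cards0 eqxx andbT; apply/andP; split; apply/forall_inP => K; rewrite inE //.
have Pb n : P n -> n <= #|{set G}|.
  by case/existsP=> U /existsP[h /andP[_ /eqP <-]]; apply: max_card.
have [n /existsP[U /existsP[h /andP[lUh /eqP Un]]] nmax] := ex_maxnP P0 Pb.
exists U, h; split=> // K KK1 KU x y xK yK xy; apply: contraT => nl.
pose h' := [ffun L => if L == K then (x, y) else h L].
suff : P n.+1 by move/nmax; rewrite ltnn.
apply/existsP; exists (K |: U); apply/existsP; exists h'.
rewrite cardsU1 KU Un eqxx andbT.
have h'U L : L \in U -> h' L = h L.
  by move=> LU; rewrite ffunE; case: eqP => // e; rewrite -e LU in KU.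
have h'K : h' K = (x, y) by rewrite ffunE eqxx.
have fresh L : L \in U -> (h L != (x, y)) && (h L != (y, x)).
  move=> LU; rewrite -negb_or; apply: contra nl => hL; apply/linkP; exists L => //.
  by case/orP: hL => /eqP; auto.
apply/andP; split; apply/forall_inP => L; rewrite in_setU1 => /orP[/eqP->|LU].
- by rewrite h'K KK1 /= xK yK xy.
- by rewrite h'U //; apply/and4P; have [] := linkingP lUh LU.
- apply/forall_inP => M; rewrite in_setU1 => /orP[/eqP->|MU]; first by rewrite eqxx.
  rewrite h'K h'U //; apply/implyP => _; have /andP[m1 m2] := fresh M MU.
  rewrite eq_sym m1 /=; apply: contra m2 => /eqP[-> ->]; by rewrite -surjective_pairing.
- apply/forall_inP => M; rewrite in_setU1 => /orP[/eqP->|MU].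
    by rewrite h'K h'U //=; have /andP[-> ->] := fresh L LU; rewrite implybT.
  by rewrite !h'U //; case/andP: lUh => _ /forall_inP/(_ L LU)/forall_inP/(_ M MU).
Qed.


(* A vertex x has at most 12 neighbours in [link U h] among the remaining vertices.
   An unlinked set with x in its coboundary, which is a clique, is counted at a pair
   (y, z) of neighbours of x in the coboundary, with y = z if there is only one, and
   at most two sets are counted at each of these 12 * 12 pairs. *)
Lemma card_unlinked U h : linking U h ->
  (forall K, K \in KK -> K \notin U -> {in coboundary K &, forall x y, x != y -> link U h x y}) ->
  #|KK :\: U| <= 288 * #|X|.
Proof.
move=> lUh clique; pose F := link U h.
pose L (J : {set G}) := [set K in KK :\: U | coboundary K \subset J].
have LK J K : K \in L J -> [/\ K \in KK, K \notin U & coboundary K \subset J].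
  by rewrite inE in_setD => /andP[/andP[]].
suff bound n (J : {set G}) : #|J| = n -> J \subset X -> #|L J| <= 288 * #|J|.
  apply: leq_trans (bound _ X erefl (subxx X)); apply: subset_leq_card.
  by apply/subsetP => K KU; rewrite inE KU cobX //; move: KU; rewrite in_setD => /andP[].
elim: n J => [|n IH] J Jn JX.
  rewrite Jn muln0 leqn0 cards_eq0 -subset0; apply/subsetP => K /LK[KK1 _].
  have -> : J = set0 by apply/eqP; rewrite -cards_eq0 Jn.
  by rewrite subset0 -cards_eq0 => /eqP c0; have := cob2 KK1; rewrite c0.
have [x xJ x12] : exists2 x, x \in J & deg J F x <= 12.
  apply/exists_inP; apply: contraT => /exists_inPn big.
  have := link_density lUh JX; rewrite leqNgt => /negP[].
  apply: leq_trans (_ : \sum_(x in J) 13 <= _); first by rewrite sum_nat_const Jn; lia.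
  by apply: leq_sum => x /big; rewrite -ltnNge.
pose M := [set y in J | F x y].
pose S (p : G * G) := [set K in KK :\: U | [&& x \in coboundary K, p.1 \in coboundary K,
  p.2 \in coboundary K & (p.1 == p.2) ==> (#|coboundary K| == 2)]].
have S2 p : p \in setX M M -> #|S p| <= 2.
  case: p => y z; rewrite !inE /= => /andP[/andP[yJ xy] /andP[zJ xz]].
  have ne w : F x w -> x != w by apply: contraTneq => <-; rewrite /F (link_irr lUh).
  have SK : S (y, z) \subset KK by apply/subsetP => K; rewrite inE in_setD => /andP[/andP[]].
  case: (eqVneq y z) => [yz|yz]; last first.
    apply: common_coboundary SK (ne y xy) (ne z xz) yz _ => K.
    by rewrite inE => /and5P[_ -> -> ->].
  apply: leq_trans (_ : _ <= 1) _ => //; apply/card_le1_eqP => K K' K1 K2.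
  have pair K0 : K0 \in S (y, z) -> #|coboundary K0| = 2 /\ coboundary K0 = [set x; y].
    rewrite inE => /and5P[_ xK yK _]; rewrite /= yz eqxx /= => /eqP c2; split=> //.
    apply/eqP; rewrite eq_sym eqEcard c2 cards2 ne ?yz // andbT.
    by apply/subsetP => w; rewrite in_set2 => /orP[]/eqP-> //; rewrite -yz.
  have [c1 e1] := pair K K1; have [_ e2] := pair K' K2.
  exact: esym (uniq2 (subsetP SK K K1) (subsetP SK K' K2) c1 (etrans e1 (esym e2))).
have step : L J \subset L (J :\ x) :|: \bigcup_(p in setX M M) S p.
  apply/subsetP => K KL; have [KK1 KU KJ] := LK J K KL.
  have [xK|xK] := boolP (x \in coboundary K); last first.
    by rewrite in_setU inE in_setD KK1 KU subsetD1 KJ xK.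
  have inM y : y \in coboundary K -> x != y -> y \in M.
    by move=> yK xy; rewrite inE (subsetP KJ) //=; apply: (clique K).
  have [y yK xy] : exists2 y, y \in coboundary K & x != y.
    have : 0 < #|coboundary K :\ x| by have := cob2 KK1; rewrite (cardsD1 x) xK.
    by case/card_gt0P=> y; rewrite in_setD1 eq_sym => /andP[]; exists y.
  rewrite in_setU; apply/orP; right; apply/bigcupP.
  have [c2|c2] := eqVneq #|coboundary K| 2.
    exists (y, y); first by rewrite in_setX /= inM.
    by rewrite inE in_setD KK1 KU xK yK c2 implybT.
  have [z] : exists z, z \in coboundary K :\ x :\ y.
    apply/card_gt0P; have := cob2 KK1; move: c2.
    rewrite (cardsD1 x) xK (cardsD1 y (_ :\ x)) in_setD1 [y == x]eq_sym xy yK; lia.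
  rewrite !in_setD1 => /and3P[zy zx zK]; exists (y, z).
    by rewrite in_setX /= !inM // eq_sym.
  by rewrite inE in_setD KK1 KU xK yK zK /= eq_sym (negPf zy).
apply: leq_trans (subset_leq_card step) _; apply: leq_trans (leq_card_setU _ _) _.
have Jx : #|J :\ x| = n by move: Jn; rewrite (cardsD1 x) xJ => -[].
have := IH (J :\ x) Jx (subset_trans (subsetDl _ _) JX); rewrite Jx Jn => IHx.
suff : #|\bigcup_(p in setX M M) S p| <= 288 by lia.
apply: leq_trans (card_bigcup_leq _ _) _; apply: leq_trans (_ : \sum_(p in setX M M) 2 <= _).
  by apply: leq_sum => p; apply: S2.
rewrite sum_nat_const cardsX; move: x12; rewrite deg_card -/M; nia.
Qed.

(* 1806 = 6 * (1 + 12 + 288). *)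
Lemma sum_coboundary : \sum_(K in KK) #|coboundary K| <= 1806 * #|X|.
Proof.
have [->|[K0 K0K]] := set_0Vmem KK; first by rewrite big_set0.
have [x0 _] : exists x, x \in coboundary K0.
  by apply/card_gt0P; apply: leq_trans _ (cob2 K0K).
have [U [h [lUh clique]]] := maximal_linking x0.
have cU := card_linking lUh; have cD := card_unlinked lUh clique.
have cK : #|KK| <= #|U| + #|KK :\: U|.
  by rewrite -(cardsID U KK); apply: leq_add => //; apply/subset_leq_card/subsetIr.
(* The bipartite incidence graph between [X] and [KK], realized with single vertices and the sets
   themselves as branch sets. Each incidence is counted twice in [edges], so the 12 of [density]
   becomes a 6. *)
pose F : rel (G + {set G}) := fun a b =>
  match a, b with inl x, inr K | inr K, inl x => x \in coboundary K | _, _ => false end.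
pose J : {set G + {set G}} := [set a | match a with inl x => x \in X | inr K => K \in KK end].
pose P (a : G + {set G}) := match a with inl x => [set x] | inr K => K end.
have Fs : symmetric F by case=> [x|K] [y|L].
have Fi : irreflexive F by case=> [x|K].
have cobT K x : x \in coboundary K -> touch K [set x].
  by case/coboundaryP=> _ [v vK vx]; exists v, x; rewrite inE.
have rJ : realized J P F.
  split.
  - by case=> [x|K]; rewrite inE => KJ; [apply: conn1 | apply: connK].
  - case=> [x|K] [y|L]; rewrite !inE => aJ bJ ab /=.
    + by rewrite disjoints1 inE; apply: contraNneq ab => ->.
    + by rewrite disjoints1; have := disjX bJ; rewrite disjoint_sym => /disjointFr ->.
    + by rewrite disjoint_sym disjoints1; have := disjX aJ; rewrite disjoint_sym => /disjointFr ->.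
    + by apply: disjK => //; apply: contraNneq ab => ->.
  - case=> [x|K] [y|L] _ _ //=; last exact: cobT.
    by move/cobT/touch_sym.
have := density freeG Fs Fi rJ.
have cardJ : #|J| = #|X| + #|KK|.
  rewrite -!sum1_card big_sumType /=.
  by congr (_ + _); apply: eq_bigl => a; rewrite inE.
have -> : edges J F = \sum_(K in KK) #|coboundary K| + \sum_(K in KK) #|coboundary K|.
  have split (f : G + {set G} -> nat) :
      \sum_(a in J) f a = \sum_(x in X) f (inl x) + \sum_(K in KK) f (inr K).
    rewrite big_sumType /=.
    by congr (_ + _); apply: eq_bigl => a; rewrite inE.
  have col K : K \in KK -> \sum_(x in X) (x \in coboundary K : nat) = #|coboundary K|.
    move=> KK1; rewrite -sum1_card big_mkcond [RHS]big_mkcond /=; apply: eq_bigr => x _.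
    by case: (boolP (x \in X)) => // xX; case: (boolP (x \in coboundary K)) => // /(subsetP (cobX KK1)); rewrite (negPf xX).
  rewrite /edges /deg split; congr (_ + _).
    under eq_bigr => x _ do rewrite split big1 //.
    by rewrite exchange_big /=; apply: eq_bigr => K /col.
  by apply: eq_bigr => K KK1; rewrite split (big1 _ (fun L => L \in KK)) ?addn0 //; apply: col.
rewrite cardJ; lia.
Qed.

End Count.

(** * Components and wallets *)

Import Order.TTheory GRing.Theory Num.Theory.
Import boolp Drawings.

Section Components.
Variables (G : sgraph) (U : {set G}).
Implicit Types (A : {set G}) (x y : G).

Definition component x : {set G} := [set y | connect (restr U) x y].
Definition components : {set {set G}} := [set component x | x in U].

Lemma component_eq x y : connect (restr U) x y -> component x = component y.
Proof.
move=> xy; apply/setP => z; rewrite !inE.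
exact: same_connect (@restr_csym G U) x y xy z.
Qed.

Lemma componentP A y : A \in components -> y \in A -> y \in U /\ A = component y.
Proof.
case/imsetP=> x xU ->; rewrite inE => xy; split; last exact: component_eq.
exact: connect_restr_in xy xU.
Qed.

Lemma component_conn A : A \in components -> conn A.
Proof.
case/imsetP=> x xU ->; split; first by apply/set0Pn; exists x; rewrite inE connect0.
suff from y : connect (restr U) x y -> connect (restr (component x)) x y.
  move=> y z; rewrite !inE => /from xy /from xz.
  by apply: connect_trans xz; rewrite restr_csym.
case/connectP=> c + ->; elim/last_ind: c => [|c z IH]; first by move=> _; apply: connect0.
rewrite rcons_path last_rcons => /andP[xc cz]; apply: connect_trans (IH xc) _.
have xl : connect (restr U) x (last x c) by apply/connectP; exists c.
apply: connect1; have /and3P[_ _ lz] := cz.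
by rewrite /restr /= !inE xl lz (connect_trans xl (connect1 cz)).
Qed.

Lemma components_disjoint : {in components &, forall A B, A != B -> [disjoint A & B]}.
Proof.
move=> A B CA BC AB; apply: disjoint_notin => y yA; apply: contra AB => yB.
by have [_ ->] := componentP CA yA; have [_ ->] := componentP BC yB.
Qed.

Lemma components_apart A B : A \in components -> B \in components -> A != B -> non_touching A B.
Proof.
move=> CA BC AB; split; first exact: components_disjoint.
move=> x y xA yB; apply: contra AB => xy.
have [xU ->] := componentP CA xA; have [yU ->] := componentP BC yB.
by apply/eqP/component_eq/connect_restr_adj.
Qed.

Lemma component_coboundary A : A \in components -> coboundary A \subset ~: U.
Proof.
move=> CA; apply/subsetP => y /coboundaryP[yA [v vA vy]]; rewrite inE; apply: contra yA => yU.
have [vU ->] := componentP CA vA; rewrite inE; exact: connect_restr_adj.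
Qed.

Lemma sum_components : \sum_(A in components) #|A| = #|U|.
Proof.
have -> : U = cover components.
  apply/setP => x; apply/idP/bigcupP => [xU|[A CA xA]]; last by have [] := componentP CA xA.
  by exists (component x); [apply: imset_f | rewrite inE connect0].
apply/eqP; rewrite eq_sym; have /trivIsetP := components_disjoint.
by rewrite /trivIset eq_sym.
Qed.

End Components.

Lemma conn_induced (G : sgraph) (A : {set G}) : conn A -> connected_graph (induced A).
Proof.
case=> /set0Pn[a aA] cA; split; first by apply/card_gt0P; exists (Sub a aA : induced_vertex A).
move=> x y; have /connectP[c] := cA _ _ (valP x) (valP y).
elim: c x => [|z c IH] x /=; first by move=> _ /val_inj->; apply: connect0.
case/andP=> /and3P[_ zA xz] zc yl.
by apply: connect_trans (connect1 _) (IH (Sub z zA : induced_vertex A) zc yl).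
Qed.

(** * Components that are purses *)

Section Purses.
Variables (R : realType) (G : sgraph).
Hypothesis planarG : planar R G.
Implicit Types (A B : {set G}).

Definition purse_val A (x : add_clique [set x : induced (coboundary A :|: A) |
  val x \in coboundary A]) : G := val (x : induced_vertex (coboundary A :|: A)).

Lemma purse_adj A (x y : add_clique [set x : induced (coboundary A :|: A) |
    val x \in coboundary A]) : adj x y -> adj (purse_val x) (purse_val y) \/
  [/\ purse_val x \in coboundary A, purse_val y \in coboundary A & purse_val x != purse_val y].
Proof.
case/orP; first by left.
by case/and3P=> xS yS xy; right; rewrite in_set in xS; rewrite in_set in yS; rewrite (inj_eq val_inj).
Qed.

(** A coboundary with at most one vertex adds no edge, so the graph in question is a subgraph of
    [G]. *)
Lemma purse_small A : conn A -> #|coboundary A| <= 1 -> purse R A.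
Proof.
move=> cA cob1; split; [exact: conn_induced | exact: leq_trans cob1 _ |].
apply: (@planar_embed R _ G (@purse_val A)) planarG; first exact: val_inj.
move=> x y /purse_adj[//|[xS yS /eqP[]]].
by move/card_le1_eqP: cob1 => /(_ _ _ yS xS).
Qed.

Lemma purse_pair A B : conn A -> conn B -> [disjoint A & B] ->
  coboundary A = coboundary B -> #|coboundary A| = 2 -> purse R A.
Proof.
move=> cA cB dAB cobAB cob2; split; [exact: conn_induced | by rewrite cob2 |].
have C2 : #|coboundary A| == 2 by rewrite cob2.
have [u [v [uv Suv]]] := elimT (cards2P _) C2.
have uA : u \in coboundary A by rewrite Suv set21.
have vA : v \in coboundary A by rewrite Suv set22.
apply: (@planar_add_edge R _ G (@purse_val A) B u v); rewrite -?cobAB //.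
- exact: val_inj.
- move=> x y /purse_adj[xy|[]]; first by constructor 1.
  rewrite Suv !in_set2 => /orP[]/eqP-> /orP[]/eqP-> /eqP// _; by [constructor 2 | constructor 3].
- move=> x; have : purse_val x \in coboundary A :|: A := valP (x : induced_vertex _).
  move: (purse_val x) => w; rewrite in_setU => /orP[|xA].
    by rewrite cobAB => /coboundaryP[].
  by rewrite (disjointFr dAB).
Qed.

End Purses.

(** * Choice of constants and the wallet *)

Section Wallet.
Variables (R : realType) (G : sgraph) (k : R) (K M dg D : nat).
Hypotheses (planarG : planar R G) (k1 : (1 <= k)%R) (kK : (k <= K%:R)%R).
Hypotheses (KM : K * 1806 + 1 <= M) (Mdg : 48 * M <= dg.+1) (MD : 12 * M <= D).

Let size := dg.+1 ^ (17 * D).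

(** Sparsity gives 48 M |X0| <= 12 v(G) for the vertices of large degree, and the chops delete at
    most 3 v(G) / D <= v(G) / (4 M) vertices, so 2 M |X| <= v(G). As M >= 1806 K + 1, the set X and
    the bad components cover at most M |X| <= v(G) / 2 vertices. The other half lies in components
    with at most [size] vertices. Adding [dg] to [size] lets one constant bound the degrees too. *)
Lemma exists_wallet : exists W : {set {set G}}, deep_wallet k (size + dg)%:R W.
Proof.
have K0 : 0 < K by rewrite -(ltr0n R); apply: lt_le_trans kK; apply: lt_le_trans k1.
have freeG := planar_K33_free planarG.
pose X0 : {set G} := [set v | dg < degree v].
have X0M : 4 * (M * #|X0|) <= #|G|.
  have rG : realized setT (fun x : G => [set x]) (@adj G).
    split=> [x _|x y _ _ xy|x y _ _ xy]; first exact: conn1.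
      by rewrite disjoints1 inE.
    by exists x, y; rewrite !inE.
  have := density freeG (@adj_sym G) (@adj_irr G) rG; rewrite cardsT.
  have : \sum_(x in X0) (48 * M) <= edges setT (@adj G).
    rewrite /edges big_mkcond [X in _ <= X]big_mkcond; apply: leq_sum => x _.
    rewrite !inE; case: ifP => // dx.
    have -> : deg setT (@adj G) x = degree x.
      by rewrite deg_card; apply: eq_card => y; rewrite !inE.
    by apply: leq_trans Mdg _.
  rewrite sum_nat_const; clear; nia.
have deg1 y : y \in ~: X0 -> degree y <= dg by rewrite !inE -leqNgt.
have D0 : 0 < D by apply: leq_trans MD; rewrite muln_gt0 /=; apply: leq_trans KM; rewrite addn1.
have [U [UX0 UD Usmall]] := fragment freeG D0 deg1.
pose X := ~: U.
have XM : 2 * (M * #|X|) <= #|G|.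
  have cX : #|X| = #|X0| + #|~: X0 :\: U|.
    rewrite -(cardsID X0 X); congr (_ + _); apply: eq_card => x; last first.
      by rewrite /X !in_setD !in_setC andbC.
    rewrite /X in_setI in_setC; have := subsetP UX0 x; rewrite in_setC.
    by case: (x \in U) => [/(_ isT)/negPf->|].
  have : #|~: X0| <= #|G| by apply: max_card.
  rewrite cX; move: UD X0M MD; clear; nia.
pose CC := components U.
have compC A : A \in CC -> conn A by apply: component_conn.
have small A : A \in CC -> #|A| <= size by case/imsetP=> x xU ->; apply: Usmall.
pose W := [set A in CC | `[< purse R A \/ deep k A >]].
pose KK := CC :\: W.
have KC A : A \in KK -> A \in CC by rewrite in_setD => /andP[].
have KW A : A \in KK -> ~ purse R A /\ ~ deep k A.
  rewrite in_setD => /andP[+ CA]; rewrite inE CA => /asboolPn notW.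
  by split=> h; apply: notW; [left | right].
have cob2 A : A \in KK -> 2 <= #|coboundary A|.
  move=> AK; rewrite ltnNge; apply/negP => c1; have [nP _] := KW A AK.
  by apply/nP/purse_small => //; apply/compC/KC.
have sumK : \sum_(A in KK) #|coboundary A| <= 1806 * #|X|.
  apply: (sum_coboundary freeG) => //.
  - by move=> A /KC/compC.
  - by move=> A B /KC CA /KC BC; apply: (components_disjoint CA BC).
  - move=> A /KC CA; apply: disjoint_notin => y yA; rewrite inE negbK.
    by have [] := componentP CA yA.
  - by move=> A /KC/component_coboundary.
  - move=> A B AK BK c2 cAB; apply/eqP; apply: contraT => AB; have [nP _] := KW A AK.
    case: nP; apply: (purse_pair planarG (compC _ (KC _ AK)) (compC _ (KC _ BK)) _ cAB c2).
    by apply: (components_disjoint (KC _ AK) (KC _ BK)).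
have badA A : A \in KK -> #|A| <= K * #|coboundary A|.
  move=> AK; have [_ nD] := KW A AK; rewrite -(ler_nat R) leNgt; apply/negP => big.
  apply: nD; split; first by rewrite -card_gt0; apply: leq_trans (cob2 A AK).
  have k0 : (0 < k)%R by apply: lt_le_trans k1.
  rewrite ler_pdivlMl //; apply: le_trans (ltW big); rewrite natrM.
  by apply: ler_wpM2r.
have WC : W \subset CC by apply/subsetP => A; rewrite inE => /andP[].
have cover : #|G| <= #|X| + \sum_(A in KK) #|A| + #|W| * size.
  have -> : #|G| = #|X| + #|U| by rewrite addnC cardsC.
  rewrite -addnA leq_add2l -sum_components -/CC (big_setID W) /= (setIidPr WC) addnC.
  rewrite leq_add2l -sum_nat_const; apply: leq_sum => A AW.
  exact/small/(subsetP WC).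
exists W; split; last by move=> A; rewrite inE => /andP[_ /asboolP].
split.
- move=> A /(subsetP WC) CA; split.
  + exact/conn_induced/compC.
  + by rewrite ler_nat; apply: leq_trans (small A CA) (leq_addr _ _).
  + move=> v vA; rewrite ler_nat; apply: leq_trans (leq_addl _ _).
    by apply/deg1/(subsetP UX0); have [] := componentP CA vA.
- by move=> A B /(subsetP WC) CA /(subsetP WC); apply: components_apart.
- have half : #|G| <= 2 * (size + dg) * #|W|.
    have : \sum_(A in KK) #|A| <= K * (1806 * #|X|).
      by apply: leq_trans (leq_mul (leqnn K) sumK); rewrite big_distrr; apply: leq_sum.
    move: cover XM KM; clear; nia.
  have s0 : (0 < (size + dg)%:R :> R)%R.
    by rewrite ltr0n addn_gt0 expn_gt0.
  by rewrite ler_pdivrMl ?mulr_gt0 // -!natrM ler_nat.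
Qed.

End Wallet.

Local Open Scope ring_scope.

Theorem theorem2p3 (R : realType) (k : R) (hk : 1 <= k) :
  exists C : R, 0 < C /\
    forall G : sgraph, planar R G ->
      exists W : {set {set G}}, deep_wallet k C W.
Proof.
have kK : k <= (Num.truncn k).+1%:R by apply: ltW; apply: truncnS_gt.
set K := (Num.truncn k).+1 in kK; pose M := (K * 1806 + 1)%N.
exists (((48 * M).+1 ^ (17 * (12 * M)) + 48 * M)%:R); split.
  by rewrite ltr0n addn_gt0 expn_gt0.
by move=> G planarG; apply: (exists_wallet planarG hk kK (leqnn M) (leqnSn _) (leqnn _)).
Qed.
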